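(* There is an absolute constant $C>0$ such that the following holds. Let $n\ge 2$ be an integer, let $\mathbb{F}_q$ be a finite field of characteristic $p>2$, let $\chi_2$ be the quadratic character of $\mathbb{F}_q$, and let $d \in \mathbb{F}_q^*$. If $\chi_2(d) = (-1)^{n-1}$, then \[ \left| \#\mathcal{I}_{d,n} - \frac{2}{n} q^{n-1} \right| \le C n^2 q^{n-3/2}, \] and $\#\mathcal{I}_{d,n} = 0$ otherwise.
   Context: $\mathbb{F}_q$ denotes the finite field of $q$ elements and $\#S$ the cardinality of a finite set $S$. The discriminant of a monic polynomial $f$ of degree $n$ with roots $\alpha_1,\ldots,\alpha_n$ (with multiplicity, in an algebraic closure) is $\mathrm{discr} f = \prod_{1\le i<j\le n}(\alpha_i-\alpha_j)^2$. $\mathcal{I}_{d,n}$ is the set of all monic irreducible polynomials $X^n + a_{n-1}X^{n-1}+\cdots+a_0$ of degree $n$ over $\mathbb{F}_q$ with all coefficients $a_0,\ldots,a_{n-1}$ non-zero and with discriminant equal to $d$. *)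

(* Defs.v *)
From HB Require Import structures.
From mathcomp Require Import all_boot all_order all_algebra all_field.

Set Implicit Arguments.
Unset Strict Implicit.
Unset Printing Implicit Defensive.

Import Order.TTheory GRing.Theory Num.Theory.

Local Open Scope ring_scope.

Definition alg_closure (F : finFieldType) : countClosedFieldType :=
  projT1 (countable_algebraic_closure F).

Definition to_closure (F : finFieldType) : {rmorphism F -> alg_closure F} :=
  sval (projT2 (countable_algebraic_closure F)).

(* The roots, with multiplicity: the list is specified by
   f = lead_coef f *: \prod_(a <- closure_roots f) ('X - a%:P)
   over the closure. *)
Definition closure_roots (F : finFieldType) (f : {poly F}) :
    seq (alg_closure F) :=
  sval (closed_field_poly_normal (map_poly (to_closure F) f)).

(* Only meaningful for monic f.  The value lies in the image of to_closure F
   and does not depend on the order in which the roots are listed. *)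
Definition discr (F : finFieldType) (f : {poly F}) : alg_closure F :=
  let r := closure_roots f in
  \prod_(j < size r) \prod_(i < size r | (i < j)%N) (r`_i - r`_j) ^+ 2.

Definition quad_char (F : finFieldType) (x : F) : int :=
  if x == 0 then 0 else if [exists y : F, x == y ^+ 2] then 1 else - 1.

(* {poly_(n.+1) F} is the finite type of polynomials of degree at most n. *)
Definition irr_discr_set (F : finFieldType) (d : F) (n : nat) :
    {set {poly_(n.+1) F}} :=
  [set f : {poly_(n.+1) F} |
    [&& size f == n.+1, (f : {poly F}) \is monic, irreducibleb f,
        [forall i : 'I_n, (f : {poly F})`_i != 0]
      & discr f == to_closure F d]].

(* Main.v *)
Require Import Defs.
From HB Require Import structures.
From mathcomp Require Import all_boot all_order all_fingroup all_algebra all_field.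
From mathcomp Require Import reals exp.
From mathcomp Require Import zify ring lra.

(** Write q for the order of F, L for its algebraic closure, u_k for
X^(q^k) - X and Q for q^n.

A monic irreducible polynomial of degree n is the same thing as a Frobenius
orbit x, x^q, ..., x^(q^(n-1)) of n distinct elements of L with x^Q = x
([irreducible_orbit], [orbit_irreducible]). The product V(x) of the
differences of the conjugates squares to the discriminant, and
V(x)^(q-1) = (-1)^(n-1). This is the parity condition of Stickelberger: no
polynomial is left when the quadratic character of d has the wrong sign
([irr_discr_empty]). Otherwise fix e with e^2 = d. Then n times the number of
polynomials of discriminant d is the number of x with V(x) = e or V(x) = -e
([count_two_values]), and the point is that each of these two values is taken
about q^(n-1) times.

V is homogeneous of degree D = n(n-1)/2, so with m = gcd(D, q-1) and
r = (q-1)/m the value e is taken as often as every other value v with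
v^r = e^r, and it is enough to count the x with V(x)^r = e^r
([count_value_scale]). They form one of the m classes into which the x with
V(x) != 0 fall. The count is made by the method of Stepanov: a polynomial
vanishing to high order M at every x whose class lies in a given set of s
classes bounds the number of these x by (s/m) Q + O(n q^(n-1/2))
([stepanov_sqrt_discr]). One class gives the upper bound, and the
other m - 1 classes together give the lower bound
([count_value_bounds]).

The quality of the bound depends on the polynomial used to compute V. On the
set x^Q = x the factors of V for the gaps k and n - k are conjugate up to
sign, so up to sign V agrees with a product of powers of the u_k with k <= n/2
([sqrt_discr], [discr_sqrt]). The error term is, up to a factor n, the square
root of Q times a product of two degrees: the degree of [conductor], which
carries the zeros and has degree about q^floor(n/2), and the degree of
[sqrt_discr]^r divided by Q/m, which is about q^floor((n-1)/2). The two
exponents add up to n - 1, and the error is about q^(n-1/2).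

Polynomials with a zero coefficient are negligible: multiplying all roots by l
keeps a zero coefficient in its place and multiplies the discriminant by
l^(n(n-1)), so that the polynomials with a given zero coefficient are spread
over many discriminants ([card_irr_zero_coef]). Finally, when n^2 > q the
estimate is weaker than the remark that different polynomials have disjoint
sets of n roots among the Q solutions of x^Q = x ([trivial_estimate]). *)

Set Implicit Arguments.
Unset Strict Implicit.
Unset Printing Implicit Defensive.

Import Order.TTheory GRing.Theory Num.Theory.

Local Open Scope ring_scope.

(** * Auxiliary polynomials with many multiple zeros *)

Lemma nontrivial_solution (L : fieldType) (I J : finType) (phi : I -> J -> L) :
  (#|J| < #|I|)%N ->
  exists a : I -> L, (exists i, a i != 0) /\
    forall j, \sum_i a i * phi i j = 0.
Proof.
move=> ltJI.
pose A : 'M[L]_(#|I|, #|J|) := \matrix_(i, j) phi (enum_val i) (enum_val j).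
have /rowV0Pn[v /sub_kermxP vA0 v_neq0] : kermx A != 0.
  by rewrite kermx_eq0 /row_free neq_ltn (leq_ltn_trans (rank_leq_col A)).
exists (fun i => v 0 (enum_rank i)); split.
  have [i vi_neq0] : exists i, v 0 i != 0.
    by apply/existsP; apply: contraR v_neq0; rewrite negb_exists => /forallP v0;
      apply/eqP/rowP => i; rewrite mxE; apply/eqP; rewrite -[_ == _]negbK v0.
  by exists (enum_val i); rewrite enum_valK.
move=> j; have /rowP/(_ (enum_rank j)) := vA0.
rewrite !mxE => E0; rewrite -[RHS]E0 (reindex (fun k : 'I_#|I| => enum_val k)) /=; last first.
  by exists enum_rank => i _; rewrite ?enum_valK ?enum_rankK.
by apply: eq_bigr => i _; rewrite mxE enum_valK enum_rankK.
Qed.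

Section RescaledShift.

Variable (L : fieldType) (c : {poly L}).

(** The polynomial A(Y + c(Y) Z) in the variable Z. Its coefficient of Z^l is the
l-th Hasse derivative of A times c^l, which makes the Leibniz rule
multiplicativity and keeps everything polynomial where a logarithmic
derivative would have poles at the zeros of c. *)
Definition rescaled_shift (A : {poly L}) : {poly {poly L}} :=
  (A^:P^:P).['X%:P + c%:P * 'X].

Lemma rescaled_shiftM A B :
  rescaled_shift (A * B) = rescaled_shift A * rescaled_shift B.
Proof. by rewrite /rescaled_shift !rmorphM /= hornerM. Qed.

Lemma rescaled_shiftX A i : rescaled_shift (A ^+ i) = rescaled_shift A ^+ i.
Proof. by rewrite /rescaled_shift !rmorphXn /= horner_exp. Qed.

Lemma coef_rescaled_shift A l : (rescaled_shift A)`_l = A^`N(l) * c ^+ l.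
Proof.
have eval_Y (B : {poly L}) : (B^:P^:P).['X%:P] = B%:P.
  by rewrite horner_map /= -/(comp_poly 'X B) comp_polyXr.
have -> : rescaled_shift A =
    \sum_(i < size (A^:P^:P)) (A^`N(i) * c ^+ i)%:P * 'X^i.
  rewrite /rescaled_shift nderiv_taylor; last exact: mulrC.
  apply: eq_bigr => i _; rewrite !nderivn_map eval_Y exprMn mulrA.
  by rewrite rmorphM rmorphXn.
rewrite coef_sum; under eq_bigr do rewrite coefCM coefXn.
have size_A : (size (A^:P^:P) = size A).
  by rewrite !size_map_inj_poly //; exact: polyC_inj.
rewrite size_A; case: (ltnP l (size A)) => [ltl|lel].
  rewrite (bigD1 (Ordinal ltl)) //= eqxx mulr1 big1 ?addr0 // => i.
  by rewrite eq_sym -val_eqE /= => /negPf->; rewrite mulr0.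
rewrite nderivn_poly0 // mul0r big1 // => i _.
by rewrite gtn_eqF ?mulr0 // (leq_trans (ltn_ord i)).
Qed.

Definition slow_growth (E : {poly {poly L}}) :=
  forall l, (size (E`_l)%R <= l * (size c).-1 + 1)%N.

Lemma slow_growthM E E' : slow_growth E -> slow_growth E' -> slow_growth (E * E').
Proof.
move=> sE sE' l; rewrite coefM; apply: (leq_trans (size_sum _ _ _)).
apply/bigmax_leqP => i _; apply: (leq_trans (size_polyMleq _ _)).
have := sE i; have := sE' (l - i)%N; have := ltn_ord i.
move: (size c).-1 (size _) (size _) => d x y; nia.
Qed.

Lemma slow_growthX E i : slow_growth E -> slow_growth (E ^+ i).
Proof.
move=> sE; elim: i => [|i IH]; last by rewrite exprS; exact: slow_growthM.
by move=> l; rewrite expr0 coef1; case: l => [|l] /=; rewrite ?size_poly1 ?size_poly0 ?mul0n.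
Qed.

(** Hasse derivatives of A are A times a rational function whose denominators are
powers of c and whose numerators have degree growing linearly with the
order. A high power A = u^v with u dividing c has this property with a bound
that does not depend on v, and this is what makes the number of vanishing
conditions in the method of Stepanov small. *)
Definition log_smooth (A : {poly L}) :=
  exists2 E, slow_growth E & rescaled_shift A = A%:P * E.

Lemma log_smoothM A B : log_smooth A -> log_smooth B -> log_smooth (A * B).
Proof.
move=> [E sE shE] [E' sE' shE']; exists (E * E'); first exact: slow_growthM.
by rewrite rescaled_shiftM shE shE' rmorphM /= mulrACA.
Qed.

Lemma log_smoothX A i : log_smooth A -> log_smooth (A ^+ i).
Proof.
move=> [E sE shE]; exists (E ^+ i); first exact: slow_growthX.
by rewrite rescaled_shiftX shE exprMn rmorphXn.
Qed.

(** All terms of u(Y + c(Y) Z) except the first contain a factor c, in which the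
divisor u can be split off. *)
Lemma log_smooth_dvd u : c != 0 -> u %| c -> log_smooth u.
Proof.
move=> c_neq0 /dvdpP[v cE].
have [u_neq0 v_neq0] : u != 0 /\ v != 0.
  by apply/andP; move: c_neq0; rewrite cE mulf_eq0 negb_or andbC.
pose e l := if l is l'.+1 then u^`N(l) * c ^+ l' * v else 1.
exists (\poly_(l < size u) e l).
  move=> l; rewrite coef_poly; case: ifP => [ltl|_]; last by rewrite size_poly0.
  case: l ltl => [|l] /= ltl; first by rewrite size_poly1.
  have size_nd : (size (u^`N(l.+1)) <= size u - l.+1)%N by exact: size_poly.
  have := size_polyMleq (u^`N(l.+1) * c ^+ l) v.
  have := size_polyMleq (u^`N(l.+1)) (c ^+ l).
  have := size_poly_exp_leq c l.
  have : (size c = (size v + size u).-1)%N by rewrite cE size_mul.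
  have : (0 < size v)%N by rewrite size_poly_gt0.
  set x := size (_ * v); set y := size (_ * c ^+ l); set z := size u^`N(_).
  move: size_nd ltl; rewrite -/z; set a := size v; set b := size u.
  set t := size c; set r := size (c ^+ l); move: x y z a b t r => x y z a b t r.
  nia.
apply/polyP => l; rewrite coef_rescaled_shift coefCM coef_poly.
case: ltnP => [|lel]; last by rewrite nderivn_poly0 // mul0r mulr0.
case: l => [|l] _ /=; first by rewrite nderivn0 expr0.
by rewrite exprS {1}cE; ring.
Qed.

End RescaledShift.

Lemma size_mul_leq (R : nzRingType) (A B : {poly R}) a b :
  (size A <= a.+1)%N -> (size B <= b.+1)%N -> (size (A * B)%R <= (a + b).+1)%N.
Proof. by move=> sA sB; apply: leq_trans (size_polyMleq _ _) _; lia. Qed.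

Lemma dvdp_sum (L : fieldType) (I : finType) (P : pred I) (d : {poly L})
    (A : I -> {poly L}) :
  (forall i, P i -> d %| A i) -> d %| \sum_(i | P i) A i.
Proof. by move=> dA; elim/big_ind: _ => // x y; exact: dvdp_add. Qed.

Lemma dvdp_exp_nderivn (L : fieldType) (A : {poly L}) (x : L) M :
  (forall l, (l < M)%N -> (A^`N(l)).[x] = 0) -> ('X - x%:P) ^+ M %| A.
Proof.
move=> A0.
have -> : A = \sum_(i < size (A^:P)) (A^`N(i)).[x]%:P * ('X - x%:P) ^+ i.
  rewrite -{1}(comp_polyXr A) /comp_poly -{1}['X](subrKC x%:P).
  rewrite nderiv_taylor; last exact: mulrC.
  by apply: eq_bigr => i _; rewrite nderivn_map horner_map.
apply: dvdp_sum => i _; case: (ltnP i M) => [ltiM|leMi].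
  by rewrite A0 // mul0r dvdp0.
by rewrite dvdp_mull // dvdp_exp2l.
Qed.

Lemma size_multiple_roots (L : fieldType) (A : {poly L}) (S : seq L) M :
  A != 0 -> uniq S -> (forall x, x \in S -> ('X - x%:P) ^+ M %| A) ->
  (M * size S <= (size A).-1)%N.
Proof.
move=> A_neq0 uS dvdA.
suff dvd_prod : \prod_(x <- S) ('X - x%:P) ^+ M %| A.
  rewrite prodrXl in dvd_prod; have := dvdp_leq A_neq0 dvd_prod.
  rewrite mulnC -[size S]/((size S).+1.-1) -(size_prod_XsubC S id) -size_exp.
  by rewrite -!subn1 => /(leq_sub2r 1).
elim: S uS dvdA => [|x S IH] /= => [_ _|/andP[xS uS] dvdA]; first by rewrite big_nil dvd1p.
rewrite big_cons Gauss_dvdp ?dvdA ?mem_head //=; last first.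
  rewrite prodrXl coprimep_expl // coprimep_expr // coprimep_sym coprimep_XsubC.
  by rewrite root_prod_XsubC.
by apply: IH => // y yS; apply: dvdA; rewrite inE yS orbT.
Qed.

(** The summand of least order of vanishing at x cannot be cancelled by the
others. *)
Lemma distinct_orders_neq0 (L : fieldType) (I : finType) (a : I -> L)
    (G : I -> {poly L}) (o : I -> nat) (x : L) :
  injective o -> (forall i, (G i).[x] != 0) -> (exists i, a i != 0) ->
  \sum_i a i *: (('X - x%:P) ^+ o i * G i) != 0.
Proof.
move=> inj_o G_neq0 [i0 ai0]; apply/eqP => sum0.
case: (@arg_minnP I i0 (fun i => a i != 0) o ai0) => i ai min_i.
have : ('X - x%:P) ^+ (o i).+1 %| a i *: (('X - x%:P) ^+ o i * G i).
  move: sum0; rewrite (bigD1 i) //= => /eqP; rewrite addr_eq0 => /eqP->.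
  rewrite dvdpNr; apply: dvdp_sum => j jNi.
  have [->|aj] := eqVneq (a j) 0; first by rewrite scale0r dvdp0.
  rewrite dvdpZr // dvdp_mulr // dvdp_exp2l // ltn_neqAle min_i // andbT.
  by apply: contra jNi => /eqP/inj_o->.
rewrite dvdpZr // exprS mulrC dvdp_mul2l ?expf_neq0 ?polyXsubC_eq0 //.
by rewrite dvdp_XsubCl rootE (negPf (G_neq0 i)).
Qed.

(** The map reads off a number from mixed-radix digits: e is the weight of the
middle digit and the hypotheses exclude carries. *)
Lemma digits_inj (Q e K m : nat) (i i' j j' r r' : nat) :
  (K <= e)%N -> (m.-1 * e + K <= Q)%N -> (i < m)%N -> (i' < m)%N ->
  (r < K)%N -> (r' < K)%N ->
  (r + i * e + Q * j = r' + i' * e + Q * j')%N -> [/\ i = i', j = j' & r = r'].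
Proof.
move=> Ke mQ im i'm rK r'K E.
have lt_e x k : (k < m)%N -> (x < K)%N -> (x + k * e < Q)%N by nia.
have := lt_e _ _ im rK; have := lt_e _ _ i'm r'K => {lt_e} l' l.
have Ej : j = j'.
  have := congr1 (divn^~ Q) E; rewrite ![(Q * _)%N]mulnC !divnDMl; try lia.
  by rewrite !divn_small.
have {}E : (r + i * e = r' + i' * e)%N by move: E; rewrite Ej => /addIn.
have Ei : i = i'.
  have := congr1 (divn^~ e) E; rewrite !divnDMl; try lia.
  by rewrite !divn_small //; lia.
by split=> //; move: E; rewrite Ei => /addIn.
Qed.

(** Below order Q the factor b X^Q is invisible. *)
Lemma coef_low_mul (R : comNzRingType) (A : {poly R}) a b Q j l : (l < Q)%N ->
  (A * (a%:P + b *: 'X^Q) ^+ j)`_l = A`_l * a ^+ j.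
Proof.
move=> lQ; elim: j => [|j IH] in A *; first by rewrite !expr0 !mulr1.
rewrite exprSr mulrA mulrDr coefD -scalerAr coefZ coefMXn lQ mulr0 addr0.
by rewrite coefMC IH exprSr mulrA.
Qed.

Section Stepanov.

Variables (L : fieldType) (Q : nat) (c g g1 : {poly L}) (x0 : L) (e : nat).
Hypotheses (Q_pchar : [pchar L].-nat Q) (smooth_g : log_smooth c g).
Hypotheses (smooth_x0 : log_smooth c ('X - x0%:P)).
Hypotheses (gE : g = ('X - x0%:P) ^+ e * g1) (g1x0 : g1.[x0] != 0).

(** The auxiliary polynomial is a combination Psi of the products
(X - x0)^r g^i (X - x0)^(Qj). Since g has order e at x0, these products have
distinct orders at x0, so Psi is nonzero as soon as one coefficient is. At a
point x of S the value of g is an element w of Omega and (x - x0)^Q is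
x - x0^Q, hence the Hasse derivatives of Psi of order l < M, multiplied by c(x)^l, are
values at x of polynomials of small degree which depend only on w and l; making
these polynomials vanish is a linear system with fewer equations than
unknowns. Comparing the M-fold zeros of Psi with its degree bounds the size
of S. *)
Lemma stepanov (S Omega : seq L) (m J K M : nat) :
  (K <= e)%N -> (m.-1 * e + K <= Q)%N -> (M <= Q)%N ->
  uniq S ->
  (forall x, x \in S -> [/\ x ^+ Q = x, c.[x] != 0 & g.[x] \in Omega]) ->
  (size Omega * M * (K + M * (size c).-1 + J) < m * J * K)%N ->
  (M * size S <= K + m * (size g).-1 + Q * J)%N.
Proof.
move=> Ke mQ MQ uS S_prop few_conditions.
case: smooth_g => Eg slow_Eg shift_g; case: smooth_x0 => E0 slow_E0 shift_x0.
pose T := ('X - x0%:P) ^+ Q.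
pose I := ('I_m * 'I_J * 'I_K)%type.
pose B (u : I) := ('X - x0%:P) ^+ u.2 * g ^+ u.1.1.
pose E (u : I) := E0 ^+ u.2 * Eg ^+ u.1.1.
pose W := (K + M * (size c).-1 + J)%N.
pose R (u : I) (l : nat) (w : L) :=
  w ^+ u.1.1 *: (('X - x0%:P) ^+ u.2 * (E u)`_l * ('X - (x0 ^+ Q)%:P) ^+ u.1.2).
have size_R u l w : (l < M)%N -> (size (R u l w) <= W)%N.
  move=> lM; apply: (leq_trans (size_scale_leq _ _)).
  have slow_E : slow_growth c (E u).
    exact: (slow_growthM (slow_growthX _ slow_E0) (slow_growthX _ slow_Eg)).
  have leW : ((u.2 + l * (size c).-1 + u.1.2).+1 <= W)%N.
    rewrite /W; have := ltn_ord u.2; have := ltn_ord u.1.2.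
    move: (u.1.2 : nat) (u.2 : nat) (size c).-1 => j r d; nia.
  apply: leq_trans leW; apply: size_mul_leq; last by rewrite size_exp_XsubC.
  by apply: size_mul_leq; [rewrite size_exp_XsubC | rewrite -addn1 slow_E].
pose C := ('I_M * 'I_(size Omega) * 'I_W)%type.
have [|a [a_neq0 a_sol]] := @nontrivial_solution L I C
  (fun u v => (R u v.1.1 Omega`_v.1.2)`_v.2).
  by rewrite !card_prod !card_ord; move: few_conditions; rewrite -/W; lia.
pose Psi := \sum_u a u *: (B u * T ^+ u.1.2).
have Psi_neq0 : Psi != 0.
  pose o (u : I) := (u.2 + u.1.1 * e + Q * u.1.2)%N.
  have inj_o : injective o.
    move=> [[i j] r] [[i' j'] r'] /(digits_inj Ke mQ (ltn_ord i) (ltn_ord i') (ltn_ord r) (ltn_ord r')).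
    by case=> /= /val_inj-> /val_inj-> /val_inj->.
  have PsiE : Psi = \sum_u a u *: (('X - x0%:P) ^+ o u * g1 ^+ u.1.1).
    apply: eq_bigr => u _; congr (_ *: _); rewrite /B /T gE exprMn -!exprM /o !exprD.
    by rewrite [(e * _)%N]mulnC; ring.
  by rewrite PsiE distinct_orders_neq0 // => u; rewrite horner_exp expf_neq0.
have size_Psi : ((size Psi).-1 <= K + m * (size g).-1 + Q * J)%N.
  rewrite -subn1 leq_subLR addnC.
  apply: (leq_trans (size_sum _ _ _)); apply/bigmax_leqP => u _.
  apply: (leq_trans (size_scale_leq _ _)); rewrite /B /T -exprM.
  have leW : ((u.2 + (size g).-1 * u.1.1 + Q * u.1.2).+1 <= K + m * (size g).-1 + Q * J + 1)%N.
    have := ltn_ord u.2; have := ltn_ord u.1.2; have := ltn_ord u.1.1.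
    move: (u.1.2 : nat) (u.2 : nat) (u.1.1 : nat) (size g).-1 => j r i d; nia.
  apply: leq_trans leW; apply: size_mul_leq; last by rewrite size_exp_XsubC.
  by apply: size_mul_leq; [rewrite size_exp_XsubC | exact: size_poly_exp_leq].
apply: leq_trans size_Psi; apply: size_multiple_roots => // x xS.
have [xQ cx gx] := S_prop x xS.
apply: dvdp_exp_nderivn => l lM.
apply: (mulIf (expf_neq0 l cx)); rewrite mul0r -horner_exp -hornerM.
rewrite -coef_rescaled_shift.
have Tx : T.[x] = x - x0 ^+ Q.
  rewrite /T horner_exp !hornerE; have := @exprDn_pchar _ x (- x0) _ Q_pchar.
  by rewrite xQ => ->; rewrite exprNn_pchar.
(* T = X^Q - x0^Q, so its shift has no terms of order between 1 and Q - 1. *)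
have shift_T : rescaled_shift c T = T%:P + (c ^+ Q) *: 'X^Q.
  have Q_pchar2 : [pchar {poly {poly L}}].-nat Q.
    by rewrite (eq_pnat _ (pchar_poly _)) (eq_pnat _ (pchar_poly _)).
  rewrite /T rescaled_shiftX {1}/rescaled_shift !rmorphB /= !map_polyX !map_polyC /=.
  rewrite !hornerE addrAC exprDn_pchar // -rmorphB -rmorphXn exprMn -rmorphXn.
  by rewrite mul_polyC.
have shift_B u : rescaled_shift c (B u) = (B u)%:P * E u.
  rewrite /B /E rescaled_shiftM !rescaled_shiftX shift_g shift_x0 !exprMn.
  by rewrite mulrACA rmorphM !rmorphXn.
rewrite coef_rescaled_shift linear_sum mulr_suml horner_sum.
have ltO : (index g.[x] Omega < size Omega)%N by rewrite index_mem.
have R0 : \sum_u a u *: R u l g.[x] = 0.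
  apply/polyP => k; rewrite coef_sum coef0; under eq_bigr do rewrite coefZ.
  case: (ltnP k W) => [kW|Wk]; last first.
    by rewrite big1 // => u _; rewrite nth_default ?mulr0 // (leq_trans (size_R _ _ _ lM)).
  by have := a_sol (Ordinal lM, Ordinal ltO, Ordinal kW); rewrite /= nth_index.
have := congr1 (horner^~ x) R0; rewrite horner0 horner_sum; apply: etrans.
apply: eq_bigr => u _; rewrite linearZ -scalerAl !hornerZ; congr (_ * _).
rewrite -coef_rescaled_shift rescaled_shiftM rescaled_shiftX shift_T shift_B.
rewrite coef_low_mul; last exact: leq_trans lM MQ.
rewrite coefCM !hornerM [(T ^+ _).[x]]horner_exp Tx !horner_exp !hornerXsubC.
ring.
Qed.

End Stepanov.

(** * Finite fields inside an algebraically closed field *)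

Section FiniteFieldClosure.

Variables (F : finFieldType) (L : closedFieldType) (iota : {rmorphism F -> L}).

Local Notation q := #|F|.

Lemma card_field_gt1 : (1 < q)%N.
Proof. exact: finRing_gt1. Qed.

Lemma pchar_nat_card k : [pchar L].-nat (q ^ k)%N.
Proof.
have [p p_pr pF] := finPcharP F; rewrite (card_pprimeChar pF) -expnM.
by rewrite pnatX pnatE // (rmorph_pchar iota pF) orTb.
Qed.

Lemma frobB (x y : L) k : (x - y) ^+ (q ^ k) = x ^+ (q ^ k) - y ^+ (q ^ k).
Proof. by rewrite exprDn_pchar ?pchar_nat_card // exprNn_pchar ?pchar_nat_card. Qed.

Lemma frob_inj k : injective (fun x : L => x ^+ (q ^ k)).
Proof.
move=> x y /eqP; rewrite -subr_eq0 -frobB expf_eq0 => /andP[_].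
by rewrite subr_eq0 => /eqP.
Qed.

Lemma fixed_by_frob (x : L) : x ^+ q = x -> exists y, x = iota y.
Proof.
move=> xq; have /(congr1 (map_poly iota)) := finField_genPoly F.
rewrite rmorphB /= map_polyXn map_polyX rmorph_prod /= => /(congr1 (horner^~ x)).
rewrite !hornerE xq subrr horner_prod => /esym/eqP.
rewrite prodf_seq_eq0 => /hasP[y _ /=].
rewrite map_polyXsubC hornerXsubC subr_eq0 => /eqP->; by exists y.
Qed.

Lemma frob_iota (y : F) k : iota y ^+ (q ^ k) = iota y.
Proof.
rewrite -rmorphXn; congr (iota _); elim: k => [|k IH]; first by rewrite expr1.
by rewrite expnSr exprM IH expf_card.
Qed.

Definition frob_poly k : {poly L} := 'X^(q ^ k) - 'X.

Lemma frob_poly_eval k x : (frob_poly k).[x] = x ^+ (q ^ k) - x.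
Proof. by rewrite !hornerE. Qed.

Lemma expn_card_gt1 k : (0 < k)%N -> (1 < q ^ k)%N.
Proof. by move=> k_gt0; rewrite -(exp1n k) ltn_exp2r // card_field_gt1. Qed.

Lemma size_frob_poly k : (0 < k)%N -> size (frob_poly k) = (q ^ k).+1.
Proof.
move=> k_gt0; rewrite size_polyDl ?size_polyXn // size_polyN size_polyX.
by rewrite ltnS expn_card_gt1.
Qed.

Lemma frob_poly_neq0 k : (0 < k)%N -> frob_poly k != 0.
Proof. by move=> /size_frob_poly sz; rewrite -size_poly_gt0 sz. Qed.

Lemma frob_poly_monic k : (0 < k)%N -> frob_poly k \is monic.
Proof.
move=> k_gt0; rewrite monicE lead_coefDl ?lead_coefXn //.
by rewrite size_polyN size_polyX size_polyXn ltnS expn_card_gt1.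
Qed.

Lemma deriv_frob_poly k : (0 < k)%N -> (frob_poly k)^`() = -1.
Proof.
move=> k_gt0; have [p p_pr pF] := finPcharP F; have pL := rmorph_pchar iota pF.
have qk0 : (q ^ k)%:R = 0 :> L.
  apply/eqP; rewrite natrX expf_eq0 k_gt0 /= (card_pprimeChar pF) natrX expf_eq0.
  rewrite (pcharf0 pL) eqxx andbT lt0n; apply/eqP => l0.
  by have := card_field_gt1; rewrite (card_pprimeChar pF) l0.
rewrite derivB derivXn derivX -mulr_natr -polyC_natr qk0 mulr0 sub0r //.
Qed.

Definition frob_fixed k : seq L := sval (closed_field_poly_normal (frob_poly k)).

Lemma frob_fixedE k : (0 < k)%N ->
  frob_poly k = \prod_(x <- frob_fixed k) ('X - x%:P).
Proof.
move=> k_gt0; apply: etrans (svalP (closed_field_poly_normal (frob_poly k))) _.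
by rewrite -/(frob_fixed k) (monicP (frob_poly_monic k_gt0)) scale1r.
Qed.

Lemma frob_fixed_uniq k : (0 < k)%N -> uniq (frob_fixed k).
Proof.
move=> k_gt0; rewrite -separable_prod_XsubC -frob_fixedE // unlock.
by rewrite deriv_frob_poly // -scaleN1r coprimepZr ?oppr_eq0 ?oner_eq0 // coprimep1.
Qed.

Lemma mem_frob_fixed k x : (0 < k)%N -> (x \in frob_fixed k) = (x ^+ (q ^ k) == x).
Proof.
move=> k_gt0; rewrite -root_prod_XsubC -frob_fixedE // rootE frob_poly_eval.
by rewrite subr_eq0.
Qed.

Lemma size_frob_fixed k : (0 < k)%N -> size (frob_fixed k) = (q ^ k)%N.
Proof.
move=> k_gt0; have := size_frob_poly k_gt0.
by rewrite (frob_fixedE k_gt0) size_prod_XsubC => -[].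
Qed.

(** The derivative of X^(q^k) - X is the constant -1, so its zeros are simple. *)
Lemma frob_poly_order k x : (0 < k)%N -> exists2 v : {poly L},
  frob_poly k = ('X - x%:P) ^+ root (frob_poly k) x * v & v.[x] != 0.
Proof.
move=> k_gt0; case rx: (root _ x); last first.
  by exists (frob_poly k); rewrite ?expr0 ?mul1r // -rootE rx.
have /factor_theorem[v uE] := rx; exists v; first by rewrite mulrC.
have := congr1 (horner^~ x) (deriv_frob_poly k_gt0).
rewrite uE derivM derivXsubC !hornerE subrr mulr0 add0r => ->.
by rewrite oppr_eq0 oner_eq0.
Qed.

End FiniteFieldClosure.

(** * A low-degree square root of the discriminant *)

Lemma prod_nat_flip (R : comPzRingType) (G : nat -> R) a n : (a <= n)%N ->
  \prod_(a <= k < n) G k = \prod_(1 <= k < (n - a).+1) G (n - k)%N.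
Proof.
move=> le_an; rewrite -{1}[a]add0n big_addn big_nat_rev /= big_add1 /=.
by apply: eq_big_nat => i lt_i; congr G; lia.
Qed.

Section CyclicPairs.

Variables (R : comPzRingType) (b : nat -> nat -> R).

Let diagonal n k := \prod_(0 <= i < n - k) b i (i + k)%N.

Lemma prod_pairs_by_gap n :
  \prod_(0 <= j < n) \prod_(0 <= i < j) b i j = \prod_(1 <= k < n) diagonal n k.
Proof.
elim: n => [|n IH]; first by rewrite !big_geq.
case: (posnP n) IH => [-> _|n_gt0 IH]; first by rewrite big_nat1 !big_geq.
rewrite big_nat_recr //= IH [RHS]big_nat_recr //=.
have diagS k : (1 <= k < n)%N -> diagonal n.+1 k = diagonal n k * b (n - k)%N n.
  move=> kn; rewrite /diagonal subSn; last lia.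
  by rewrite big_nat_recr //=; congr (_ * b _ _); lia.
rewrite (eq_big_nat _ _ diagS) big_split /= -mulrA; congr (_ * _).
rewrite [LHS](prod_nat_flip (fun i => b i n)) // subn0 big_nat_recr //=.
by rewrite /diagonal subSnn big_nat1 add0n subnn.
Qed.

Variable n : nat.
Hypotheses (sym_b : forall i j, b i j = b j i).
Hypotheses (per_b : forall i j, b i (j + n)%N = b i j).

(** In a cycle of length n the pairs with gap k and the pairs with gap n - k form
together one full orbit of rotations; for even n the gap n/2 is its own
partner and contributes a half orbit. *)
Lemma prod_pairs_cyclic : (0 < n)%N ->
  \prod_(0 <= j < n) \prod_(0 <= i < j) b i j =
    (\prod_(1 <= k < (n.-1./2).+1) \prod_(0 <= i < n) b i (i + k)%N) *
    (if odd n then 1 else \prod_(0 <= i < n./2) b i (i + n./2)%N).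
Proof.
move=> n_gt0; rewrite prod_pairs_by_gap.
have diag_pair k : (k <= n)%N ->
    diagonal n k * diagonal n (n - k) = \prod_(0 <= i < n) b i (i + k)%N.
  move=> kn; rewrite [RHS](@big_cat_nat _ _ _ (n - k)) ?leq_subr //=; congr (_ * _).
  rewrite -[in RHS](add0n (n - k)%N) big_addn /diagonal; apply: eq_big_nat => i _.
  by rewrite sym_b -(per_b (i + (n - k))%N); congr b; lia.
have nE := odd_double_half n.
have n1E : n.-1 = (odd n.-1 + n.-1./2.*2)%N by rewrite odd_double_half.
have odd_n1 : odd n.-1 = ~~ odd n by rewrite -{2}(prednK n_gt0) /= negbK.
have k0_lt : ((n.-1./2).+1 <= n)%N by move: n1E; lia.
rewrite (@big_cat_nat _ _ _ (n.-1./2).+1) //= (prod_nat_flip _ k0_lt).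
have -> : (n - (n.-1./2).+1)%N = (n.-1./2 + ~~ odd n)%N.
  by move: n1E; rewrite odd_n1; case: (odd n) nE; lia.
case: (boolP (odd n)) nE => oddn nE /=.
  rewrite addn0 mulr1 -big_split /=; apply: eq_big_nat => k kn.
  by apply: diag_pair; lia.
rewrite addn1 [X in _ * X = _]big_nat_recr //= mulrA -big_split /=; congr (_ * _).
  by apply: eq_big_nat => k kn; apply: diag_pair; lia.
rewrite /diagonal; have -> : (n - (n.-1./2).+1 = n./2)%N.
  by move: n1E; rewrite odd_n1 oddn /=; lia.
by have -> : (n - n./2 = n./2)%N by lia.
Qed.

End CyclicPairs.

Section SqrtDiscr.

Variables (F : finFieldType) (L : closedFieldType) (iota : {rmorphism F -> L}).
Variable n : nat.
Hypothesis n_gt0 : (0 < n)%N.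

Local Notation q := #|F|.
Local Notation u := (@frob_poly F L).
Local Notation h := n./2.
Local Notation k0 := (n.-1./2).

Definition low_prod k : {poly L} := \prod_(1 <= i < k.+1) u i.
Definition full_weight := (\sum_(i < n) q ^ i)%N.
Definition half_weight := (if odd n then 0 else \sum_(i < h) q ^ i)%N.
(** The product of the differences of the conjugates of x, up to sign, written
with gaps at most n/2 only. At a point with x^Q = x the power
u_k(x)^(1 + q + ... + q^(n-1)) is the norm of u_k(x); for even n the
self-paired gap n/2 contributes only the first half of the conjugates. *)
Definition sqrt_discr : {poly L} :=
  low_prod k0 ^+ full_weight * u h ^+ half_weight.

Lemma low_prod_eval k x : (low_prod k).[x] = \prod_(1 <= i < k.+1) (x ^+ (q ^ i) - x).
Proof. by rewrite horner_prod; apply: eq_bigr => i _; rewrite frob_poly_eval. Qed.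

Lemma frob_fixedX (x : L) k i : x ^+ (q ^ k) = x -> x ^+ (q ^ (i * k)) = x.
Proof.
by move=> xk; elim: i => [|i IH]; rewrite ?expr1 // mulSn expnD exprM xk.
Qed.

Lemma frob_card (x : L) i : x ^+ q = x -> x ^+ (q ^ i) = x.
Proof. by move=> xq; rewrite -[i]muln1; apply: frob_fixedX; rewrite expn1. Qed.

Lemma prod_frob (y : L) m : y ^+ (\sum_(i < m) q ^ i) = \prod_(0 <= i < m) y ^+ (q ^ i).
Proof.
rewrite big_mkord; elim: m => [|m IH]; first by rewrite !big_ord0.
by rewrite !big_ord_recr /= exprD IH.
Qed.

Lemma weight_card m : (q.-1 * (\sum_(i < m) q ^ i) = (q ^ m).-1)%N.
Proof. by rewrite predn_exp. Qed.

Lemma double_half_even : ~~ odd n -> (h + h = n)%N.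
Proof. by move=> /even_halfK; rewrite addnn. Qed.

(** A nonzero norm lies in F, so its power q - 1 is 1. For even n the element
y = x^(q^(n/2)) - x satisfies y^(q^(n/2)) = -y, which gives the sign. *)
Lemma sqrt_discr_pow (x : L) : x ^+ (q ^ n) = x -> sqrt_discr.[x] != 0 ->
  sqrt_discr.[x] ^+ q.-1 = (-1) ^+ n.-1.
Proof.
move=> xQ; rewrite hornerM !horner_exp mulf_eq0 negb_or => /andP[Pw uw].
have P_neq0 : (low_prod k0).[x] != 0.
  apply: contraNneq Pw => ->; rewrite expr0n; case: (full_weight =P 0)%N => [w0|]; last by rewrite eqxx.
  have := weight_card n; rewrite -/full_weight w0 muln0.
  by have := expn_card_gt1 F n_gt0; lia.
have PQ : (low_prod k0).[x] ^+ (q ^ n) = (low_prod k0).[x].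
  rewrite low_prod_eval -prodrXl; apply: eq_bigr => i _.
  by rewrite (frobB iota) -!exprM mulnC exprM xQ.
have P1 : (low_prod k0).[x] ^+ (q ^ n).-1 = 1.
  apply: (mulfI P_neq0); rewrite -exprS prednK ?mulr1 //.
  by rewrite expn_gt0 (ltnW (card_field_gt1 F)).
rewrite exprMn -!exprM ![(_ * q.-1)%N]mulnC weight_card P1 mul1r.
move: uw; rewrite /half_weight; case: ifP => [oddn|/negbT evenn] uw.
  by rewrite muln0 expr0 -signr_odd -[n in odd n.-1]prednK //= -[odd n.-1]negbK -/(odd n.-1.+1) prednK // oddn.
have h_gt0 : (0 < h)%N by have := double_half_even evenn; lia.
rewrite weight_card frob_poly_eval; set y := _ - x in uw *.
have y_neq0 : y != 0.
  apply: contraNneq uw; rewrite frob_poly_eval -/y => ->; rewrite expr0n.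
  case: (\sum_(i < h) q ^ i =P 0)%N => [w0|]; last by rewrite eqxx.
  by have := weight_card h; rewrite w0 muln0; have := expn_card_gt1 F h_gt0; lia.
apply: (mulfI y_neq0); rewrite -exprS prednK; last first.
  by rewrite expn_gt0 (ltnW (card_field_gt1 F)).
rewrite /y (frobB iota) -exprM -expnD double_half_even // xQ -signr_odd.
have -> : odd n.-1 = true by rewrite -[odd _]negbK -/(odd n.-1.+1) prednK // evenn.
by rewrite expr1 mulrN1 opprB.
Qed.

(** Modulo q - 1 every power of q is 1, so each norm contributes l^n and the half
norm contributes l^(n/2). *)
Lemma sqrt_discr_scale (l x : L) : l ^+ q = l ->
  sqrt_discr.[l * x] = l ^+ 'C(n, 2) * sqrt_discr.[x].
Proof.
move=> lq; have scale_u i : (l * x) ^+ (q ^ i) - l * x = l * (x ^+ (q ^ i) - x).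
  by rewrite exprMn (frob_card _ lq) mulrBr.
have l_weight m : l ^+ (\sum_(i < m) q ^ i) = l ^+ m.
  rewrite prod_frob (eq_bigr (fun=> l)) => [|i _]; last exact: frob_card.
  by rewrite prodr_const_nat subn0.
rewrite !hornerM !horner_exp !low_prod_eval !frob_poly_eval.
rewrite (eq_bigr _ (fun i _ => scale_u i)) scale_u big_split /= prodr_const_nat.
rewrite !exprMn subn1 /= -!exprM [(k0 * _)%N]mulnC exprM l_weight.
have -> : l ^+ half_weight = l ^+ (if odd n then 0 else h)%N.
  by rewrite /half_weight; case: ifP.
rewrite mulrACA -exprM -exprD; congr (l ^+ _ * _).
rewrite bin2; have nE := odd_double_half n.
have n1E : n.-1 = (odd n.-1 + n.-1./2.*2)%N by rewrite odd_double_half.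
have odd_n1 : odd n.-1 = ~~ odd n by rewrite -{2}(prednK n_gt0) /= negbK.
rewrite odd_n1 in n1E; apply: double_inj.
rewrite even_halfK ?oddM ?odd_n1 ?andbN //.
by case: (odd n) nE n1E => /=; nia.
Qed.

Lemma discr_sqrt (x : L) : x ^+ (q ^ n) = x ->
  \prod_(0 <= j < n) \prod_(0 <= i < j) (x ^+ (q ^ i) - x ^+ (q ^ j)) ^+ 2 =
    sqrt_discr.[x] ^+ 2.
Proof.
move=> xQ; rewrite (@prod_pairs_cyclic _ _ n) //; first last.
- by move=> i j; rewrite expnD mulnC exprM xQ.
- by move=> i j; rewrite -sqrrN opprB.
have pairE i k : (x ^+ (q ^ i) - x ^+ (q ^ (i + k))) ^+ 2 = ((x ^+ (q ^ k) - x) ^+ (q ^ i)) ^+ 2.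
  by rewrite -sqrrN opprB (frobB iota) -exprM -expnD addnC.
have prodE k m : \prod_(0 <= i < m) (x ^+ (q ^ i) - x ^+ (q ^ (i + k))) ^+ 2 =
    ((x ^+ (q ^ k) - x) ^+ (\sum_(i < m) q ^ i)) ^+ 2.
  by under eq_bigr do rewrite pairE; rewrite prodrXl prod_frob.
rewrite hornerM !horner_exp low_prod_eval frob_poly_eval exprMn; congr (_ * _).
  by rewrite -!prodrXl; apply: eq_bigr => k _; rewrite prodE.
by rewrite /half_weight; case: ifP => _; rewrite ?expr0 ?expr1n // prodE.
Qed.

End SqrtDiscr.

(** * Stepanov's bound for the classes of the square root *)

Section StepanovDiscr.

Variables (F : finFieldType) (L : closedFieldType) (iota : {rmorphism F -> L}).
Variable n : nat.
Hypothesis n_gt2 : (2 < n)%N.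

Local Notation q := #|F|.
Local Notation u := (@frob_poly F L).
Local Notation h := n./2.
Local Notation k0 := (n.-1./2).
Local Notation P := (@low_prod F L).
Local Notation g0 := (sqrt_discr F L n).

(** A polynomial with the same zeros as [sqrt_discr] (for n > 2) but of degree only
O(q^(n/2)). *)
Definition conductor : {poly L} := P k0 * u h.

Lemma half_sizes : [/\ (0 < k0)%N, (0 < h)%N, (k0 <= h)%N, (h + k0 = n.-1)%N
  & (h.+1 < n)%N /\ (odd n -> h = k0)].
Proof.
have nE := odd_double_half n.
have n1E : n.-1 = (odd n.-1 + n.-1./2.*2)%N by rewrite odd_double_half.
have odd_n1 : odd n.-1 = ~~ odd n by rewrite -{2}(prednK (ltnW (ltnW n_gt2))) /= negbK.
rewrite odd_n1 in n1E.
by case: (odd n) nE n1E => /= nE n1E; split; try split; lia.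
Qed.

Lemma size_low_prod k : (size (P k) <= (2 * q ^ k).+1)%N.
Proof.
elim: k => [|k IH]; first by rewrite /low_prod big_geq // size_poly1.
have {}IH : (size (P k) <= (q * q ^ k).+1)%N.
  by apply: leq_trans IH _; rewrite ltnS leq_mul2r (card_field_gt1 F) orbT.
rewrite /low_prod big_nat_recr //= -/(P k).
have size_u : (size (u k.+1) <= (q ^ k.+1).+1)%N by rewrite size_frob_poly.
apply: leq_trans (size_mul_leq IH size_u) _.
by rewrite -expnS addnn mul2n.
Qed.

Lemma size_conductor : ((size conductor).-1 <= 3 * q ^ h)%N.
Proof.
have [k0_gt0 h_gt0 le_k0h _ _] := half_sizes.
have size_u : (size (u h) <= (q ^ h).+1)%N by rewrite size_frob_poly.
rewrite -subn1 leq_subLR add1n.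
apply: leq_trans (size_mul_leq (size_low_prod k0) size_u) _.
have : (q ^ k0 <= q ^ h)%N by rewrite leq_exp2l // (card_field_gt1 F).
by rewrite ltnS; lia.
Qed.

Lemma low_prod_neq0 k : P k != 0.
Proof.
rewrite /low_prod big_nat_cond prodf_seq_neq0; apply/allP => i _.
by apply/implyP => /andP[/andP[i_gt0 _] _]; rewrite frob_poly_neq0.
Qed.

Lemma conductor_neq0 : conductor != 0.
Proof.
have [_ h_gt0 _ _ _] := half_sizes.
by rewrite mulf_neq0 ?low_prod_neq0 ?frob_poly_neq0.
Qed.

Lemma dvdp_low_prod i k : (0 < i <= k)%N -> u i %| P k.
Proof.
move=> ik; rewrite /low_prod (bigD1_seq i) ?mem_index_iota ?iota_uniq //=.
by rewrite dvdp_mulr.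
Qed.

Lemma root_conductor x : root conductor x = root g0 x.
Proof.
have [k0_gt0 h_gt0 le_k0h hk [_ odd_h]] := half_sizes.
have w_gt0 m : (0 < m)%N -> (0 < \sum_(i < m) q ^ i)%N.
  by case: m => // m _; rewrite big_ord_recl expn0.
rewrite /conductor /sqrt_discr !rootM.
have root_exp (p : {poly L}) m : root (p ^+ m) x = (0 < m)%N && root p x.
  by rewrite !rootE horner_exp expf_eq0.
rewrite !root_exp w_gt0; last lia.
case: (boolP (root (P k0) x)) => //= rP.
rewrite /half_weight; case: ifP => [oddn|_]; last by rewrite w_gt0.
rewrite odd_h //; apply: contraNF rP => ru.
by apply: root_dvdp ru; rewrite dvdp_low_prod // k0_gt0 leqnn.
Qed.

(** For even n the last factor has degree q^(n/2) but only a half weight, so that,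
multiplied by q - 1, it adds at most q^n. *)
Lemma size_sqrt_discr : ((size g0).-1 * q.-1 <= 3 * q ^ n * q ^ k0)%N.
Proof.
have [k0_gt0 h_gt0 le_k0h hk [_ odd_h]] := half_sizes.
have size_Pw : (size (P k0 ^+ full_weight F n) <= (2 * q ^ k0 * full_weight F n).+1)%N.
  apply: leq_trans (size_poly_exp_leq _ _) _; rewrite ltnS leq_mul2r.
  by rewrite -subn1 leq_subLR add1n size_low_prod orbT.
have size_uw : (size (u h ^+ half_weight F n) <= (q ^ h * half_weight F n).+1)%N.
  by apply: leq_trans (size_poly_exp_leq _ _) _; rewrite size_frob_poly.
have w1 : (q.-1 * full_weight F n <= q ^ n)%N.
  by rewrite weight_card leq_pred.
have w2 : (q.-1 * half_weight F n * q ^ h <= q ^ n * q ^ k0)%N.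
  rewrite /half_weight; case: ifP => [|/negbT evenn]; first by rewrite muln0.
  rewrite weight_card; apply: (@leq_trans (q ^ h * q ^ h)).
    by rewrite leq_mul2r leq_pred orbT.
  by rewrite -expnD double_half_even // leq_pmulr // expn_gt0 ltnW ?(card_field_gt1 F).
apply: (@leq_trans ((2 * q ^ k0 * full_weight F n + q ^ h * half_weight F n) * q.-1)).
  rewrite leq_mul2r; apply/orP; right; rewrite -[(size _).-1]subn1 leq_subLR add1n.
  exact: size_mul_leq.
move: (q ^ n)%N (q ^ k0)%N (q ^ h)%N (full_weight F n) (half_weight F n) q.-1 w1 w2 => Q B A w1 w2 r.
nia.
Qed.

Hypothesis q_gt2 : (2 < q)%N.

(** Let k be the integral part of (n-1)/2. An element x0 of L of exact degree k over
F is a simple zero of u_k and not a zero of u_i for i < k; u_(n/2) is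
either the same factor, with weight zero, or contributes at most the half
weight. Hence the order of [sqrt_discr]^((q-1)/m) at x0 is close to Q/m, and
its multiples by i < m are well spread below Q. *)
Lemma sqrt_discr_order : exists x0 e g1,
  [/\ root conductor x0, g0 = ('X - x0%:P) ^+ e * g1, g1.[x0] != 0,
      ((q ^ n).-1 <= e * q.-1)%N & (e * q.-1 < (q ^ n).-1 + q ^ h)%N].
Proof.
have [k0_gt0 h_gt0 le_k0h hk [_ odd_h]] := half_sizes.
(* Zeros of u_i with i < k0 are too few to exhaust the q^k0 zeros of u_k0. *)
have [x0 x0_fix x0_new] : exists2 x0, x0 \in frob_fixed F L k0 & ~~ root (P k0.-1) x0.
  apply/hasP; rewrite -[has _ _]negbK -all_predC; apply/negP => /allP all_roots.
  have : (size (frob_fixed F L k0) < size (P k0.-1))%N.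
    apply: max_poly_roots; rewrite ?low_prod_neq0 ?(frob_fixed_uniq iota) //.
    by apply/allP => x /all_roots /=; rewrite negbK.
  rewrite size_frob_fixed //; apply/negP; rewrite -leqNgt.
  apply: leq_trans (size_low_prod _) _.
  by rewrite -[in (_ <= q ^ k0)%N](prednK k0_gt0) expnS ltn_mul2r q_gt2 andbT expn_gt0 ltnW ?(card_field_gt1 F).
have x0_root : root (u k0) x0 by rewrite frob_fixedE // root_prod_XsubC.
have [v1 u1E v1_neq0] := frob_poly_order iota x0 k0_gt0.
have [v2 u2E v2_neq0] := frob_poly_order iota x0 h_gt0.
rewrite x0_root expr1 in u1E; set b := root (u h) x0 in u2E.
have PE : P k0 = ('X - x0%:P) * (P k0.-1 * v1).
  by rewrite /low_prod -[in LHS](prednK k0_gt0) big_nat_recr //= prednK // u1E mulrCA.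
exists x0, (full_weight F n + b * half_weight F n)%N.
exists ((P k0.-1 * v1) ^+ full_weight F n * v2 ^+ half_weight F n); split.
- by rewrite rootM PE rootM root_XsubC eqxx.
- by rewrite /sqrt_discr PE u2E !exprMn exprD exprM; ring.
- by rewrite hornerM !horner_exp hornerM mulf_neq0 ?expf_neq0 ?mulf_neq0 // -rootE.
- by rewrite mulnC mulnDr weight_card leq_addr.
- rewrite mulnC mulnDr weight_card -/(full_weight F n) ltn_add2l.
  apply: (@leq_ltn_trans (q ^ h).-1); last by rewrite prednK // expn_gt0 ltnW ?(card_field_gt1 F).
  rewrite /half_weight; case: ifP => _; first by rewrite !muln0.
  by case: b {u2E}; rewrite ?mul0n ?muln0 // mul1n weight_card.
Qed.

(** The inequality between the numbers of equations and of unknowns, for an order M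
of vanishing with n^2 M^2 <= Q B / A. Here A bounds the degree of the
conductor, B is the degree scale of [sqrt_discr], and K = e - A; the
constant 20 is a convenient one that dominates all the secondary terms. *)
Lemma stepanov_few_conditions (Q A B dc m s e M J : nat) :
  (0 < m)%N -> (s <= m)%N -> (m <= n ^ 2)%N -> (16 * n ^ 2 <= Q)%N ->
  (dc <= 3 * A)%N -> (0 < A)%N -> (0 < B)%N ->
  (n ^ 2 * M ^ 2 * A <= Q * B)%N -> (n ^ 2 * M ^ 2 <= Q)%N ->
  (Q <= 2 * (m * (e - A)))%N ->
  J = (s * M %/ m + 1 + 20 * B)%N ->
  (s * M * (e - A + M * dc + J) < m * J * (e - A))%N.
Proof.
move=> m_gt0 sm mn Qn dcA A_gt0 B_gt0 MQB MQ.
set K := (e - A)%N => KQ JE.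
have floor_lt : (s * M + 1 + 20 * B * m <= m * J)%N.
  rewrite JE; have := ltn_ceil (s * M) m_gt0; rewrite !mulnDr; lia.
have floor_le : (s * M %/ m <= M)%N.
  by rewrite -[X in (_ <= X)%N](mulnK M m_gt0) leq_div2r // mulnC leq_mul2l sm orbT.
have sn : (s <= n ^ 2)%N by exact: leq_trans sm mn.
have sMM : (s * (M * M) <= Q)%N by apply: leq_trans MQ; rewrite leq_mul // mulnn.
have sMMA : (s * (M * M) * A <= Q * B)%N.
  by apply: leq_trans MQB; rewrite leq_mul // leq_mul // mulnn.
have sM4 : (4 * (s * M) <= Q)%N.
  rewrite -leq_sqr; apply: (@leq_trans (16 * n ^ 2 * (n ^ 2 * M ^ 2))).
    by rewrite 2!expnMn -mulnA leq_mul // mulnA leq_mul // -mulnn leq_mul.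
  by rewrite -[(Q ^ 2)%N]mulnn leq_mul.
have part1 : (s * M * (M * dc) <= 3 * (Q * B))%N.
  apply: (@leq_trans (s * (M * M) * (3 * A))); last by lia.
  by rewrite mulnA -[(s * M * M)%N]mulnA leq_mul.
have part2 : (s * M * J <= Q + Q + 5 * (Q * B))%N.
  have floor_part : (s * M * (s * M %/ m) <= s * (M * M))%N.
    by rewrite -mulnA leq_mul // leq_mul.
  have : (B * (4 * (s * M)) <= B * Q)%N by rewrite leq_mul2l sM4 orbT.
  by rewrite JE !mulnDr; lia.
have part3 : (10 * (Q * B) <= 20 * B * m * K)%N.
  have : (B * Q <= B * (2 * (m * K)))%N by rewrite leq_mul2l KQ orbT.
  by lia.
have part4 : (s * M * K + K + 20 * B * m * K <= m * J * K)%N.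
  by rewrite -[X in (_ + X + _)%N]mul1n -!mulnDl leq_mul2r floor_lt orbT.
have QB : (Q <= Q * B)%N by rewrite leq_pmulr.
have K_gt0 : (0 < K)%N by rewrite lt0n; apply/eqP => K0; move: KQ n_gt2 Qn; rewrite K0; nia.
by rewrite !mulnDr; lia.
Qed.

Lemma stepanov_degree (s m M Q B K J N d : nat) :
  (M * N <= K + m * d + Q * J)%N -> (K <= Q)%N -> (m * d <= 3 * Q * B)%N ->
  J = (s * M %/ m + 1 + 20 * B)%N -> (0 < B)%N ->
  (M * m * N <= s * M * Q + 25 * m * Q * B)%N.
Proof.
move=> main KQ dQB JE B_gt0.
have floorQ : (m * (Q * (s * M %/ m)) <= s * M * Q)%N.
  by rewrite mulnCA [(s * M * Q)%N]mulnC leq_mul2l mulnC leq_divM orbT.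
have : (m * (M * N) <= m * (K + m * d + Q * J))%N by rewrite leq_mul2l main orbT.
have : (m * (m * d) <= m * (3 * Q * B))%N by rewrite leq_mul2l dQB orbT.
have : (m * K <= m * Q)%N by rewrite leq_mul2l KQ orbT.
have : (m * Q <= m * Q * B)%N by rewrite leq_pmulr.
by move: floorQ; rewrite JE; move: (_ %/ _)%N => f {main KQ dQB JE B_gt0}; rewrite !mulnDr; lia.
Qed.

(** The method of Stepanov for g = [sqrt_discr]^((q-1)/m) at the point x0 of
[sqrt_discr_order]. The number K of exponents r is shortened by q^(n/2) in
order to absorb the uncertainty of the order of g at x0. *)
Lemma stepanov_sqrt_discr (m M : nat) (S Omega : seq L) :
  (n ^ 2 <= q)%N -> (0 < m)%N -> (m %| q.-1)%N -> (m <= n ^ 2)%N ->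
  (n ^ 2 * M ^ 2 <= q ^ (n + k0 - h))%N ->
  (size Omega <= m)%N -> uniq S ->
  (forall x, x \in S ->
    [/\ x ^+ (q ^ n) = x, g0.[x] != 0 & g0.[x] ^+ (q.-1 %/ m) \in Omega]) ->
  (M * m * size S <= size Omega * M * q ^ n + 25 * m * q ^ n * q ^ k0)%N.
Proof.
move=> nq m_gt0 m_dvd mn MX sm uS S_prop.
have [k0_gt0 h_gt0 le_k0h hk [hn odd_h]] := half_sizes.
have [x0 [e0 [g1 [rc gE g1_neq0 e_ge e_lt]]]] := sqrt_discr_order.
set r := (q.-1 %/ m)%N in S_prop *.
have rm : (m * r = q.-1)%N by rewrite mulnC divnK.
have q_gt0 : (0 < q)%N by lia.
pose e := (e0 * r)%N; pose Q := (q ^ n)%N; pose A := (q ^ h)%N; pose B := (q ^ k0)%N.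
have A_gt0 : (0 < A)%N by rewrite expn_gt0 q_gt0.
have B_gt0 : (0 < B)%N by rewrite expn_gt0 q_gt0.
have Q_gt0 : (0 < Q)%N by rewrite expn_gt0 q_gt0.
have me : (m * e = e0 * q.-1)%N by rewrite /e mulnCA rm.
rewrite -me -/Q -/A in e_ge e_lt.
have mA : (m * A * q <= Q)%N.
  apply: (@leq_trans (q * A * q)); first by rewrite !leq_mul // (leq_trans mn).
  by rewrite /A /Q -expnS -expnSr leq_exp2l //; lia.
have q9 : (9 <= q)%N by apply: leq_trans nq; rewrite -[9%N]/(3 ^ 2)%N leq_exp2r.
have qQ : (16 * n ^ 2 <= Q)%N.
  apply: (@leq_trans (q ^ 3)); last by rewrite /Q leq_exp2l //; lia.
  rewrite [(q ^ 3)%N]expnSr leq_mul //; apply: (@leq_trans (9 ^ 2)) => //.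
  by rewrite leq_exp2r.
have XA : (q ^ (n + k0 - h) * A = Q * B)%N.
  by rewrite /Q /A /B -!expnD; congr (_ ^ _)%N; lia.
have XQ : (q ^ (n + k0 - h) <= Q)%N by rewrite /Q leq_exp2l //; lia.
have mA9 : (9 * (m * A) <= Q)%N.
  by apply: leq_trans mA; rewrite mulnC leq_mul2l q9 orbT.
have Q9 : (9 <= Q)%N.
  by apply: leq_trans q9 _; rewrite /Q -{1}[q]expn1 leq_exp2l //; lia.
have Ae : (A <= e)%N by rewrite -(leq_pmul2l m_gt0); lia.
pose K := (e - A)%N.
have mK : (m * K = m * e - m * A)%N by rewrite mulnBr.
have KQ : (Q <= 2 * (m * K))%N by lia.
(* About s M / m values of j balance the equations and the unknowns; the last
   term pays for the degree of the conductor. *)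
pose J := (size Omega * M %/ m + 1 + 20 * B)%N.
have few := stepanov_few_conditions m_gt0 sm mn qQ size_conductor A_gt0 B_gt0 _ _ KQ (erefl J).
have {}few := few (leq_trans (leq_mul MX (leqnn A)) (eq_leq XA)) (leq_trans MX XQ).
have MQ : (M <= Q)%N.
  apply: leq_trans (leq_trans MX XQ); rewrite -[(M ^ 2)%N]mulnn mulnA.
  by case: (posnP M) => [->|M_gt0]; rewrite // leq_pmull // muln_gt0 expn_gt0 M_gt0 (ltnW (ltnW n_gt2)).
pose g := g0 ^+ r.
have conductor_dvd_P : P k0 %| conductor by rewrite dvdp_mulr.
have conductor_dvd_u : u h %| conductor by rewrite dvdp_mull.
have smooth_g : log_smooth conductor g.
  apply/log_smoothX/log_smoothM; apply: log_smoothX;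
    by apply: log_smooth_dvd; rewrite ?conductor_neq0.
have smooth_x0 : log_smooth conductor ('X - x0%:P).
  by apply: log_smooth_dvd; rewrite ?conductor_neq0 // dvdp_XsubCl.
have gE' : g = ('X - x0%:P) ^+ e * g1 ^+ r by rewrite /g gE exprMn -exprM.
have g1_neq0' : (g1 ^+ r).[x0] != 0 by rewrite horner_exp expf_neq0.
have S_prop' x : x \in S -> [/\ x ^+ Q = x, conductor.[x] != 0 & g.[x] \in Omega].
  by move=> /S_prop[xQ gx Ox]; rewrite /g horner_exp -rootE root_conductor rootE.
have size_g : (m * (size g).-1 <= 3 * Q * B)%N.
  by rewrite size_exp mulnCA rm size_sqrt_discr.
have := stepanov (pchar_nat_card iota n) smooth_g smooth_x0 gE' g1_neq0'
  (leq_subr A e) _ MQ uS S_prop' few.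
have -> : (m.-1 * e + (e - A) <= q ^ n)%N.
  have : (m.-1 * e + e = m * e)%N by rewrite -mulSnr prednK.
  rewrite -/Q addnBA // => ->; rewrite leq_subLR ltnW // (leq_trans e_lt) //.
  by rewrite addnC leq_add2l leq_pred.
move=> /(_ isT); rewrite -/Q -/K => main.
have KQ' : (K <= Q)%N.
  apply: leq_trans (leq_pmull K m_gt0) _; rewrite mK leq_subLR ltnW //.
  by rewrite (leq_trans e_lt) // addnC leq_add ?leq_pred // leq_pmull.
exact: stepanov_degree main KQ' size_g (erefl J) B_gt0.
Qed.

End StepanovDiscr.

(** * Counting elements with a prescribed square root *)

Lemma finField_unit_pow (F : finFieldType) (l : F) : l != 0 -> l ^+ #|F|.-1 = 1.
Proof.
move=> l_neq0; apply: (mulfI l_neq0).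
by rewrite -exprS prednK ?expf_card ?mulr1 // ltnW // card_field_gt1.
Qed.

Lemma power_gcd_trivial (F : finFieldType) (l : F) D : l != 0 ->
  l ^+ (D * (#|F|.-1 %/ gcdn D #|F|.-1)) = 1.
Proof.
move=> l_neq0; rewrite muln_divCA_gcd.
by rewrite exprM finField_unit_pow // expr1n.
Qed.

(** A fibre of l |-> l^D is a coset of its kernel, which consists of m-th roots of
unity, m = gcd(D, q-1), so a fibre has at most m elements. The fibres over the at
most (q-1)/m elements with y^((q-1)/m) = 1 exhaust the q - 1 units,
so that each of them has exactly m elements. *)
Lemma card_power_fiber (F : finFieldType) (D : nat) (y : F) :
  (0 < D)%N -> y ^+ (#|F|.-1 %/ gcdn D #|F|.-1) = 1 ->
  #|[set l : F | l ^+ D == y]| = gcdn D #|F|.-1.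
Proof.
set q := #|F|; set m := gcdn D q.-1; set r := (q.-1 %/ m)%N => D_gt0 yr.
have q1_gt0 : (0 < q.-1)%N by have := card_field_gt1 F; rewrite -/q; lia.
have m_gt0 : (0 < m)%N by rewrite gcdn_gt0 D_gt0.
have rm : (r * m = q.-1)%N by rewrite divnK // dvdn_gcdr.
have r_gt0 : (0 < r)%N by move: q1_gt0; rewrite -rm muln_gt0 => /andP[].
have card_roots k : (0 < k)%N -> (#|[set z : F | z ^+ k == 1%R]| <= k)%N.
  move=> k_gt0; have p_neq0 : 'X^k - 1%:P != 0 :> {poly F} by rewrite -size_poly_gt0 size_XnsubC.
  rewrite cardE -ltnS; apply: leq_trans (max_poly_roots p_neq0 _ (enum_uniq _)) _.
    by apply/allP => z; rewrite mem_enum inE rootE !hornerE subr_eq0.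
  by rewrite size_XnsubC.
pose fiber z := [set l : F | l ^+ D == z].
have fiber_le z : z ^+ r = 1 -> (#|fiber z| <= m)%N.
  move=> zr; have z_neq0 : z != 0.
    by apply: contra_eq_neq zr => ->; rewrite expr0n eqn0Ngt r_gt0 eq_sym oner_eq0.
  case: (set_0Vmem (fiber z)) => [->|[l0 l0_in]]; first by rewrite cards0.
  have l0z : l0 ^+ D = z by apply/eqP; move: l0_in; rewrite inE.
  have l0_neq0 : l0 != 0 by apply: contra_neq z_neq0 => E; rewrite -l0z E expr0n eqn0Ngt D_gt0.
  apply: leq_trans (card_roots m m_gt0).
  have inj_div : injective (fun l => l / l0) by apply: mulIf; rewrite invr_eq0.
  rewrite -(card_imset _ inj_div); apply: subset_leq_card.
  apply/subsetP => _ /imsetP[l l_in ->]; rewrite inE.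
  have lz : l ^+ D = z by apply/eqP; move: l_in; rewrite inE.
  have t_neq0 : l / l0 != 0.
    rewrite mulf_neq0 ?invr_eq0 //; apply: contra_neq z_neq0 => E.
    by rewrite -lz E expr0n eqn0Ngt D_gt0.
  have tD : (l / l0) ^+ D = 1 by rewrite exprMn exprVn lz l0z divff.
  have [a b ab _] := egcdnP q.-1 D_gt0.
  have : (l / l0) ^+ (a * D) = (l / l0) ^+ (b * q.-1 + m) by rewrite ab.
  by rewrite mulnC exprM tD expr1n exprD mulnC exprM finField_unit_pow // expr1n mul1r => <-.
pose mu := [set z : F | z ^+ r == 1].
have sum_fibers : (\sum_(z in mu) #|fiber z| = q.-1)%N.
  have <- : #|[set~ (0 : F)]| = q.-1 by rewrite cardsC1.
  rewrite -sum1_card [RHS](partition_big (fun l : F => l ^+ D) (mem mu)) /=; last first.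
    by move=> l; rewrite !inE => l_neq0; rewrite -exprM power_gcd_trivial ?eqxx.
  apply: eq_bigr => z; rewrite inE => /eqP zr; rewrite -sum1_card; apply: eq_bigl => l.
  rewrite !inE andbC; case: eqP => //= lz; apply/esym; apply: contra_eq_neq zr => l0.
  by rewrite -lz l0 expr0n [D == _]eqn0Ngt D_gt0 /= expr0n eqn0Ngt r_gt0 eq_sym oner_eq0.
have mu_y : y \in mu by rewrite inE yr.
apply/eqP; rewrite eqn_leq fiber_le //= leqNgt; apply/negP => lt_y.
have : (\sum_(z in mu) #|fiber z| < \sum_(z in mu) m)%N.
  rewrite (bigD1 y) //= [X in (_ < X)%N](bigD1 y) //= -addSn leq_add //.
  by apply: leq_sum => z; rewrite inE => /andP[/eqP zr _]; exact: fiber_le.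
rewrite sum_fibers sum_nat_const -rm ltn_mul2r [(r < _)%N]ltnNge card_roots //.
by rewrite andbF.
Qed.

Lemma count_root_le (L : fieldType) (p : {poly L}) (s : seq L) :
  p != 0 -> uniq s -> (count (root p) s <= (size p).-1)%N.
Proof.
move=> p_neq0 us; rewrite -size_filter -ltnS prednK ?size_poly_gt0 //.
by apply: max_poly_roots; rewrite ?filter_uniq // filter_all.
Qed.

Section CountValues.

Variables (F : finFieldType) (L : closedFieldType) (iota : {rmorphism F -> L}).
Variable n : nat.
Hypothesis n_gt1 : (1 < n)%N.

Local Notation q := #|F|.
Local Notation h := n./2.
Local Notation k0 := (n.-1./2).
Local Notation g0 := (sqrt_discr F L n).
Local Notation S := (frob_fixed F L n).
Local Notation m := (gcdn 'C(n, 2) q.-1).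
Local Notation r := (q.-1 %/ m)%N.

Let n_gt0 : (0 < n)%N := ltnW n_gt1.

Lemma gcd_bin_card_gt0 : (0 < m)%N.
Proof. by rewrite gcdn_gt0 bin_gt0 n_gt1. Qed.

Lemma gcd_bin_card_le : (m <= n ^ 2)%N.
Proof.
apply: leq_trans (dvdn_leq _ (dvdn_gcdl _ _)) _; first by rewrite bin_gt0.
rewrite bin2 -divn2; apply: leq_trans (leq_div _ _) _.
by rewrite -mulnn leq_mul // leq_pred.
Qed.

Lemma sum_count_seq (T : Type) (s : seq T) (a : pred T) : count a s = (\sum_(x <- s) a x)%N.
Proof. by rewrite -sum1_count big_mkcond; apply: eq_bigr => x _; case: (a x). Qed.

(** Both sides count the pairs (l, x) with l a unit of F and
[sqrt_discr](l x) = e: for fixed l the map x |-> l x permutes the solutions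
of x^Q = x, and for fixed x the admissible l form a fibre of l |-> l^D. *)
Lemma count_value_scale (e : L) : e ^+ q.-1 = (-1) ^+ n.-1 ->
  (q.-1 * count (fun x => g0.[x] == e) S = m * count (fun x => g0.[x] ^+ r == e ^+ r) S)%N.
Proof.
move=> eq1; have q_gt0 : (0 < q)%N by rewrite ltnW ?card_field_gt1.
have e_neq0 : e != 0.
  apply/eqP => e0; have := eq1; rewrite e0 expr0n; have := card_field_gt1 F.
  case: eqP => [|_ _ /esym/eqP]; first by lia.
  by rewrite signr_eq0.
have rm : (r * m = q.-1)%N by rewrite divnK // dvdn_gcdr.
have q1_gt0 : (0 < q.-1)%N by have := card_field_gt1 F; lia.
have r_gt0 : (0 < r)%N by rewrite divn_gt0 ?gcd_bin_card_gt0 // dvdn_leq // dvdn_gcdr.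
pose N l := count (fun x => g0.[iota l * x] == e) S.
have N_const l : l != 0 -> N l = count (fun x => g0.[x] == e) S.
  move=> l_neq0; rewrite /N -(count_map (fun x => iota l * x) (fun x => g0.[x] == e)).
  apply/seq.permP; apply: uniq_perm; rewrite ?(frob_fixed_uniq iota) //.
    rewrite map_inj_uniq ?(frob_fixed_uniq iota) //.
    by apply: mulfI; rewrite fmorph_eq0.
  move=> x; apply/mapP/idP => [[y]|]; rewrite !(mem_frob_fixed F) // => yq.
    by move=> ->; rewrite exprMn (frob_iota iota) (eqP yq).
  exists (iota l^-1 * x); last by rewrite mulrA -rmorphM mulfV // rmorph1 mul1r.
  by rewrite mem_frob_fixed // exprMn (frob_iota iota) (eqP yq).
transitivity (\sum_(l : F | l != 0%R) N l)%N.
  rewrite (eq_bigr _ N_const) sum_nat_const; congr (_ * _)%N.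
  by rewrite -(cardC1 (0 : F)); apply: eq_card => l; rewrite !inE.
rewrite /N; under eq_bigr do rewrite sum_count_seq.
rewrite exchange_big /= sum_count_seq big_distrr /=.
rewrite [LHS]big_seq [RHS]big_seq; apply: eq_bigr => x; rewrite mem_frob_fixed // => /eqP xQ.
have scale l : g0.[iota l * x] = iota (l ^+ 'C(n, 2)) * g0.[x].
  by rewrite (sqrt_discr_scale n_gt0) ?rmorphXn // -{1}[q]expn1 frob_iota.
case: (eqVneq (g0.[x] ^+ r) (e ^+ r)) => [gr|gr]; last first.
  rewrite muln0 big1 // => l l_neq0; apply/eqP; rewrite eqb0; apply: contra gr => /eqP <-.
  by rewrite scale exprMn -rmorphXn -exprM power_gcd_trivial // rmorph1 mul1r.
rewrite muln1.
have g_neq0 : g0.[x] != 0.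
  apply: contra_eq_neq gr => ->; rewrite expr0n eqn0Ngt r_gt0 eq_sym expf_neq0 //.
have [y yE] : exists y, e / g0.[x] = iota y.
  apply: (fixed_by_frob iota); rewrite -(prednK q_gt0) exprS exprMn exprVn eq1.
  by rewrite (sqrt_discr_pow iota n_gt0 xQ g_neq0) divff ?signr_eq0 // mulr1.
have yr : y ^+ r = 1.
  have : iota y ^+ r = 1 by rewrite -yE exprMn exprVn gr divff ?expf_neq0.
  by rewrite -rmorphXn => /eqP; rewrite fmorph_eq1 => /eqP.
have y_neq0 : y != 0 by apply: contra_eq_neq yr => ->; rewrite expr0n eqn0Ngt r_gt0 eq_sym oner_eq0.
have D_gt0 : (0 < 'C(n, 2))%N by rewrite bin_gt0.
rewrite -(card_power_fiber D_gt0 yr) -sum1_card big_mkcond [RHS]big_mkcond /=.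
apply: eq_bigr => l _; rewrite inE scale -[_ == y](inj_eq (fmorph_inj iota)) -yE.
have -> : (iota (l ^+ 'C(n, 2)) == e / g0.[x]) = (iota (l ^+ 'C(n, 2)) * g0.[x] == e).
  by rewrite -(inj_eq (mulIf g_neq0)) divfK.
case: eqVneq => [->|_]; last by case: (_ == _).
rewrite expr0n eqn0Ngt D_gt0 /= rmorph0 mul0r; case: eqP => // /esym/eqP.
by rewrite (negPf e_neq0).
Qed.

Lemma count_roots_sqrt_discr : (count (root g0) S <= 3 * q ^ h)%N.
Proof.
have uS : uniq S by rewrite (frob_fixed_uniq iota).
have [n_gt2|n_le2] := ltnP 2 n.
  under eq_count do rewrite -root_conductor //.
  apply: leq_trans (count_root_le _ uS) (size_conductor _ _ n_gt2).
  exact: conductor_neq0.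
have nE : n = 2 by lia.
have -> : g0 = frob_poly F L 1.
  by rewrite /sqrt_discr /low_prod /half_weight nE big_geq //= expr1n mul1r big_ord1 expn0 expr1.
apply: leq_trans (count_root_le _ uS) _; first exact: frob_poly_neq0.
by rewrite size_frob_poly // nE /= leq_pmull.
Qed.

(** The upper bound applies the method of Stepanov to the single class e^r, the
lower bound to the at most m - 1 other classes; the zeros of [sqrt_discr] are
the only x in no class. For n = 2 there is just one class, and counting all
x suffices. *)
Lemma count_value_bounds (e : L) M :
  (2 < q)%N -> (n ^ 2 <= q)%N -> (n ^ 2 * M ^ 2 <= q ^ (n + k0 - h))%N ->
  e ^+ q.-1 = (-1) ^+ n.-1 ->
  let N := count (fun x => g0.[x] == e) S in
  (M * (q.-1 * N) <= M * q ^ n + 25 * m * q ^ n * q ^ k0)%N /\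
  (M * q ^ n <= M * (q.-1 * N) + 25 * m * q ^ n * q ^ k0 + M * m * (3 * q ^ h))%N.
Proof.
move=> q_gt2 nq MX eq1 N; rewrite (count_value_scale eq1).
set N1 := count _ _; set Q := (q ^ n)%N; set B := (q ^ k0)%N.
have uS : uniq S by rewrite (frob_fixed_uniq iota).
have sS : size S = Q by rewrite size_frob_fixed.
have q_gt0 : (0 < q)%N by lia.
have rm : (r * m = q.-1)%N by rewrite divnK // dvdn_gcdr.
have e_neq0 : e != 0.
  apply/eqP => e0; have := eq1; rewrite e0 expr0n; case: eqP => [|_ /esym/eqP]; first by lia.
  by rewrite signr_eq0.
have [T TE] := closed_field_poly_normal ('X^m - ((-1) ^+ n.-1)%:P : {poly L}).
rewrite lead_coefDl ?size_polyXn ?size_polyN ?size_polyC ?signr_eq0 ?ltnS ?gcd_bin_card_gt0 // in TE.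
rewrite lead_coefXn scale1r in TE.
have memT w : (w \in T) = (w ^+ m == (-1) ^+ n.-1).
  by rewrite -root_prod_XsubC -TE rootE !hornerE subr_eq0.
have sizeT : size T = m.
  by have := size_XnsubC ((-1) ^+ n.-1 : L) gcd_bin_card_gt0; rewrite TE size_prod_XsubC => -[].
(* The values of g0^r at the x with g0(x) != 0 are the m-th roots of (-1)^(n-1). *)
pose Om := [seq w <- undup T | w != e ^+ r].
have size_Om : (size Om < m)%N.
  rewrite size_filter; apply: leq_trans (eq_leq sizeT); apply: leq_trans (size_undup T).
  rewrite -(count_predC (pred1 (e ^+ r)) (undup T)) -add1n.
  apply: leq_add; last exact: leqnn.
  by rewrite -has_count has_pred1 mem_undup memT -exprM rm eq1.
pose N2 := count (fun x => (g0.[x] != 0) && (g0.[x] ^+ r \in Om)) S.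
have cover : (Q <= N1 + N2 + 3 * q ^ h)%N.
  apply: leq_trans (leq_add (leqnn _) count_roots_sqrt_discr).
  rewrite -sS -sum1_size /N1 /N2 !sum_count_seq -!big_split /= big_seq [leqRHS]big_seq.
  apply: leq_sum => x; rewrite mem_frob_fixed // => /eqP xQ; rewrite rootE.
  case: (eqVneq g0.[x] 0) => [_|g_neq0]; first by rewrite addn1.
  rewrite mem_filter mem_undup memT -exprM rm (sqrt_discr_pow iota n_gt0 xQ g_neq0) eqxx andbT.
  by case: (_ == _).
have [n_le2|n_gt2] := leqP n 2.
  have nE : n = 2 by lia.
  have mE : m = 1%N by rewrite nE /= gcd1n.
  have N1Q : (N1 <= Q)%N by rewrite -sS count_size.
  have N2_0 : N2 = 0%N.
    have Om0 : Om = [::] by apply: size0nil; move: size_Om; rewrite mE; lia.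
    by rewrite /N2 Om0; under eq_count do rewrite andbF; rewrite count_pred0.
  rewrite mE !mul1n !muln1; split; first by rewrite (leq_trans _ (leq_addr _ _)) // leq_mul2l N1Q orbT.
  rewrite addnAC -mulnDr (leq_trans _ (leq_addr _ _)) // leq_mul2l.
  by move: cover; rewrite N2_0 addn0 => ->; rewrite orbT.
have m_dvd : (m %| q.-1)%N by rewrite dvdn_gcdr.
have bound Omega (a : pred L) : (size Omega <= m)%N ->
    (forall x, a x -> g0.[x] != 0 /\ g0.[x] ^+ r \in Omega) ->
    (M * m * count a S <= size Omega * M * Q + 25 * m * Q * B)%N.
  move=> sO aO; rewrite -size_filter.
  apply: (stepanov_sqrt_discr iota n_gt2 q_gt2 nq gcd_bin_card_gt0 m_dvd gcd_bin_card_le MX sO).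
    by rewrite filter_uniq.
  move=> x; rewrite mem_filter mem_frob_fixed // => /andP[ax /eqP xQ].
  by have [] := aO x ax.
have r_gt0 : (0 < r)%N by rewrite divn_gt0 ?gcd_bin_card_gt0 // dvdn_leq // ; lia.
have bound1 : (M * m * N1 <= M * Q + 25 * m * Q * B)%N.
  rewrite -[X in (_ <= X * Q + _)%N]mul1n; apply: (bound [:: e ^+ r]); first exact: gcd_bin_card_gt0.
  move=> x /eqP gr; rewrite gr mem_head; split=> //.
  apply: contra_eq_neq gr => ->.
  by rewrite expr0n eqn0Ngt r_gt0 eq_sym expf_neq0.
have bound2 : (M * m * N2 <= m.-1 * M * Q + 25 * m * Q * B)%N.
  apply: leq_trans (bound Om _ (ltnW size_Om) _) _; first by move=> x /andP[].
  by rewrite leq_add2r !leq_mul // -ltnS prednK // gcd_bin_card_gt0.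
split; first by rewrite mulnA.
have : (M * m * Q <= M * m * (N1 + N2 + 3 * q ^ h))%N by rewrite leq_mul2l cover orbT.
rewrite !mulnDr => coverM.
have splitQ : (M * m * Q = M * Q + m.-1 * M * Q)%N.
  by rewrite -{1}(prednK gcd_bin_card_gt0) mulnS mulnDl [(m.-1 * M)%N]mulnC.
rewrite -(leq_add2r (m.-1 * M * Q)) -splitQ; apply: leq_trans coverM _.
have arith (a b c d f : nat) : (b <= f + d -> a + b + c <= a + d + c + f)%N by clear; lia.
by rewrite [(M * (m * N1))%N]mulnA; apply: arith.
Qed.

End CountValues.

(** * Discriminants and Frobenius orbits *)

Definition squared_differences (R : comPzRingType) (r : seq R) : R :=
  \prod_(j < size r) \prod_(i < size r | (i < j)%N) (r`_i - r`_j) ^+ 2.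

(** The product is the square of a Vandermonde determinant, whose sign changes are
lost in the square. *)
Lemma squared_differences_perm (R : comPzRingType) (r r' : seq R) :
  perm_eq r r' -> squared_differences r = squared_differences r'.
Proof.
have vdm (n : nat) (t : n.-tuple R) :
    squared_differences t = \det (Vandermonde n (\row_j tnth t j)) ^+ 2.
  rewrite det_Vandermonde -prodrXl /squared_differences size_tuple.
  rewrite (exchange_big_dep predT) //=; apply: eq_bigr => i _.
  rewrite -prodrXl; apply: eq_bigr => j _.
  by rewrite !mxE !(tnth_nth 0) -sqrrN opprB.
move=> perm_r; have sz : size r == size r' by rewrite (perm_size perm_r).
rewrite -[r]/(tval (Tuple sz)) -[r']/(tval (in_tuple r')) !vdm.
have /tuple_permP[s rE] : perm_eq (Tuple sz) (in_tuple r') by [].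
have -> : Vandermonde (size r') (\row_j tnth (Tuple sz) j) =
    col_perm s (Vandermonde (size r') (\row_j tnth (in_tuple r') j)).
  apply/matrixP => i j; rewrite !mxE; congr (_ ^+ _).
  by rewrite (tnth_nth 0) rE -tnth_nth tnth_mktuple.
by rewrite col_permE det_mulmx det_perm exprMn sqrr_sign mulr1.
Qed.

(** The map x |-> x^q as a ring morphism of L. The embedding iota is a parameter
because it is what shows the map to be additive. *)
Definition card_frob (F : finFieldType) (L : closedFieldType)
  (iota : {rmorphism F -> L}) (x : L) : L := x ^+ #|F|.

Section CardFrobMorphism.

Variables (F : finFieldType) (L : closedFieldType) (iota : {rmorphism F -> L}).

Fact card_frob_is_additive : {morph card_frob iota : x y / x - y}.
Proof. by move=> x y; rewrite /card_frob; have := frobB iota x y 1; rewrite expn1. Qed.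

Fact card_frob_is_multiplicative : monoid_morphism (card_frob iota).
Proof. by split=> [|x y]; rewrite /card_frob ?expr1n ?exprMn. Qed.

HB.instance Definition _ :=
  GRing.isZmodMorphism.Build L L (card_frob iota) card_frob_is_additive.
HB.instance Definition _ :=
  GRing.isMonoidMorphism.Build L L (card_frob iota) card_frob_is_multiplicative.

End CardFrobMorphism.

Section FrobeniusOrbits.

Variables (F : finFieldType) (L : closedFieldType) (iota : {rmorphism F -> L}).

Local Notation q := #|F|.
Local Notation "p ^iota" := (map_poly iota p) (at level 2, format "p ^iota").

Lemma card_frob_fixed (x : L) : card_frob iota x = x -> exists y, x = iota y.
Proof. exact: (fixed_by_frob iota). Qed.

Lemma descend_poly (p : {poly L}) : map_poly (card_frob iota) p = p ->
  exists p0 : {poly F}, p = p0^iota.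
Proof.
move=> p_fixed; have coef_fixed (i : 'I_(size p)) : exists y, p`_i = iota y.
  by apply: card_frob_fixed; rewrite -coef_map /= p_fixed.
have [y yE] := fin_all_exists coef_fixed.
exists (\sum_(i < size p) (y i)%:P * 'X^i).
rewrite rmorph_sum /= -{1}(coefK p) poly_def; apply: eq_bigr => i _.
by rewrite rmorphM /= map_polyC map_polyXn yE mul_polyC.
Qed.

Definition frob_orbit (x : L) n := mkseq (fun i => x ^+ (q ^ i)) n.

Lemma root_frob (p : {poly F}) x i : root p^iota x -> root p^iota (x ^+ (q ^ i)).
Proof.
move=> /eqP px; elim: i => [|i /eqP IH]; first by rewrite expr1 rootE px.
have p_fixed : map_poly (card_frob iota) p^iota = p^iota.
  by apply/polyP => j; rewrite !coef_map /= /card_frob -{1}[q]expn1 frob_iota.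
rewrite expnSr exprM -/(card_frob iota _) -p_fixed rootE horner_map IH.
by rewrite rmorph0.
Qed.

Lemma frob_orbit_fixed x n : x ^+ (q ^ n) = x ->
  exists p : {poly F}, \prod_(y <- frob_orbit x n) ('X - y%:P) = p^iota.
Proof.
move=> xQ; apply: descend_poly; rewrite rmorph_prod /= !big_map.
under eq_bigr do rewrite map_polyXsubC /= /card_frob -exprM -expnSr.
case: n xQ => [|n] xQ; first by rewrite !big_nil.
by rewrite -/(index_iota 0 n.+1) big_nat_recr //= [RHS]big_nat_recl //= xQ expr1 mulrC.
Qed.

(** The minimal polynomial of x is the product over its Frobenius orbit, whose
coefficients are fixed by Frobenius and therefore lie in F. *)
Lemma irreducible_orbit (f : {poly F}) n x :
  irreducible_poly f -> f \is monic -> size f = n.+1 -> root f^iota x ->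
  [/\ x ^+ (q ^ n) = x, uniq (frob_orbit x n) &
      f^iota = \prod_(y <- frob_orbit x n) ('X - y%:P)].
Proof.
move=> irr_f mon_f size_f fx.
have f_neq0 : f^iota != 0 by rewrite map_poly_eq0 monic_neq0.
have all_root k : all (root f^iota) (frob_orbit x k).
  by apply/allP => _ /mapP[i _ ->]; exact: root_frob.
(* f has only n roots, so two of the first n + 1 iterates of x coincide. *)
have ex_k : exists k, (0 < k <= n)%N && (x ^+ (q ^ k) == x).
  have : ~~ uniq (frob_orbit x n.+1).
    apply/negP => /(max_poly_roots f_neq0 (all_root _)).
    by rewrite size_map size_iota size_map_poly size_f ltnn.
  case/(uniqPn 0) => i [j [lt_ij]]; rewrite size_mkseq => lt_j.
  rewrite !nth_mkseq //; last exact: ltn_trans lt_j.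
  have {1}-> : j = (j - i + i)%N by rewrite subnK // ltnW.
  rewrite expnD exprM => /esym/(frob_inj iota)/eqP xk.
  by exists (j - i)%N; rewrite xk andbT; lia.
have [k /andP[/andP[k_gt0 k_le] /eqP xk] min_k] := ex_minnP ex_k.
have uniq_k : uniq (frob_orbit x k).
  rewrite -[uniq _]negbK; apply/negP => /(uniqPn 0)[i [j [lt_ij]]]; rewrite size_mkseq => lt_j.
  rewrite !nth_mkseq //; last exact: ltn_trans lt_j.
  have {1}-> : j = (j - i + i)%N by rewrite subnK // ltnW.
  rewrite expnD exprM => /esym/(frob_inj iota)/eqP xij.
  by have := min_k (j - i)%N; rewrite xij andbT; lia.
have [p pE] := frob_orbit_fixed xk.
have size_p : size p = k.+1.
  by rewrite -(size_map_poly iota) -pE size_prod_XsubC size_mkseq.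
have dvd_pf : p %| f.
  rewrite -(dvdp_map iota) -pE; apply: uniq_roots_dvdp; first exact: all_root.
  by rewrite uniq_rootsE.
have mon_p : p \is monic by rewrite -(map_monic iota) -pE monic_prod_XsubC.
have /eqP pf : p == f.
  by rewrite -eqp_monic //; apply: irr_f.2 => //; rewrite size_p; case: (k) k_gt0.
have kn : k = n by apply/succn_inj; rewrite -size_p pf size_f.
by rewrite -kn -pf pE.
Qed.

(** A factor of positive degree has one root in the orbit, hence all of them. *)
Lemma orbit_irreducible n x : (0 < n)%N -> x ^+ (q ^ n) = x -> uniq (frob_orbit x n) ->
  exists f : {poly F}, [/\ irreducible_poly f, f \is monic, size f = n.+1 &
      f^iota = \prod_(y <- frob_orbit x n) ('X - y%:P)].
Proof.
move=> n_gt0 xQ uniq_x; have [f fE] := frob_orbit_fixed xQ; exists f.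
have mon_f : f \is monic by rewrite -(map_monic iota) -fE monic_prod_XsubC.
have size_f : size f = n.+1.
  by rewrite -(size_map_poly iota) -fE size_prod_XsubC size_mkseq.
split=> //; split=> [|d size_d dvd_df]; first by rewrite size_f.
have /closed_rootP[y dy] : size d^iota != 1%N by rewrite size_map_poly.
have : root f^iota y by apply: root_dvdp dy; rewrite dvdp_map.
rewrite -fE root_prod_XsubC => /mapP[i]; rewrite mem_iota add0n => /andP[_ lt_i] yE.
rewrite /eqp dvd_df -(dvdp_map iota) -fE; apply: uniq_roots_dvdp; last by rewrite uniq_rootsE.
apply/allP => _ /mapP[j _ ->].
have -> : x ^+ (q ^ j) = y ^+ (q ^ (n - i + j)).
  by rewrite yE -exprM -expnD addnA subnKC 1?ltnW // expnD exprM xQ.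
exact: root_frob.
Qed.

End FrobeniusOrbits.

(** * Irreducible polynomials with a prescribed discriminant *)

Lemma squared_differences_neq0 (R : idomainType) (r : seq R) :
  squared_differences r != 0 -> uniq r.
Proof.
move=> r_neq0; rewrite -[uniq r]negbK; apply: contra r_neq0.
case/(uniqPn 0) => i [j [lt_ij lt_j rij]]; rewrite /squared_differences.
rewrite (bigD1 (Ordinal lt_j)) //= (bigD1 (Ordinal (ltn_trans lt_ij lt_j))) //=.
by rewrite rij subrr expr0n !mul0r.
Qed.

Lemma squared_differences_scale (R : comPzRingType) (l : R) (r : seq R) :
  squared_differences [seq l * x | x <- r] =
    l ^+ 'C(size r, 2).*2 * squared_differences r.
Proof.
rewrite /squared_differences size_map.
have scale (j : 'I_(size r)) :
    \prod_(i < size r | (i < j)%N)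
      ([seq l * x | x <- r]`_i - [seq l * x | x <- r]`_j) ^+ 2 =
    l ^+ j.*2 * \prod_(i < size r | (i < j)%N) (r`_i - r`_j) ^+ 2.
  have term (i : 'I_(size r)) :
      ([seq l * x | x <- r]`_i - [seq l * x | x <- r]`_j) ^+ 2 =
      l ^+ 2 * (r`_i - r`_j) ^+ 2.
    by rewrite !(nth_map 0) // -mulrBr exprMn.
  rewrite (eq_bigr _ (fun i _ => term i)) big_split /=; congr (_ * _).
  rewrite prodr_const -exprM mul2n; congr (_ ^+ _.*2).
  rewrite -sum1_card -(big_mkord (fun i => i < j)%N (fun=> 1%N)).
  rewrite -(big_nat_widen 0 j (size r) predT) ?(ltnW (ltn_ord j)) //.
  by rewrite sum_nat_const_nat muln1 subn0.
rewrite (eq_bigr _ (fun j _ => scale j)) big_split /=; congr (_ * _).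
rewrite -(big_morph (fun k => l ^+ k) (exprD l) (expr0 l)).
rewrite -bin2_sum -mul2n big_mkord big_distrr /=; congr (_ ^+ _).
by apply: eq_bigr => j _; rewrite mul2n.
Qed.

Section IrreducibleCount.

Variable F : finFieldType.

Local Notation q := #|F|.
Local Notation L := (alg_closure F).
Local Notation iota := (to_closure F).
Local Notation "p ^iota" := (map_poly iota p) (at level 2, format "p ^iota").

Lemma squared_differences_orbit n (x : L) : (0 < n)%N -> x ^+ (q ^ n) = x ->
  squared_differences (frob_orbit F x n) = (sqrt_discr F L n).[x] ^+ 2.
Proof.
move=> n_gt0 xQ; rewrite -(discr_sqrt iota n_gt0 xQ) /squared_differences size_mkseq.
rewrite big_mkord; apply: eq_bigr => j _.
rewrite (big_nat_widen 0 j n predT) ?(ltnW (ltn_ord j)) // big_mkord.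
by apply: eq_bigr => i _; rewrite !nth_mkseq.
Qed.

Lemma closure_roots_perm (f : {poly F}) (r : seq L) :
  f^iota = \prod_(y <- r) ('X - y%:P) -> perm_eq (closure_roots f) r.
Proof.
move=> fE; rewrite /closure_roots; case: closed_field_poly_normal => s /= sE.
apply: prod_XsubC_eq; rewrite -fE sE -[X in _ = X *: _]/(lead_coef _).
by rewrite fE lead_coef_prod_XsubC scale1r.
Qed.

Lemma discr_split (f : {poly F}) (r : seq L) :
  f^iota = \prod_(y <- r) ('X - y%:P) -> discr f = squared_differences r.
Proof. by move=> /closure_roots_perm/squared_differences_perm. Qed.

Definition irr_with_discr (d : F) n : {set {poly_(n.+1) F}} :=
  [set f : {poly_(n.+1) F} |
    [&& size f == n.+1, (f : {poly F}) \is monic, irreducibleb f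
      & discr f == iota d]].

Lemma irr_with_discrP (d : F) n (f : {poly_(n.+1) F}) :
  reflect [/\ size f = n.+1, (f : {poly F}) \is monic,
              irreducible_poly f & discr f = iota d] (f \in irr_with_discr d n).
Proof.
rewrite inE; apply: (iffP and4P) => [[/eqP ? ? /irreducibleP ? /eqP ?]|[? ? ? ?]]; split=> //.
- exact/eqP.
- exact/irreducibleP.
- exact/eqP.
Qed.

(** Double counting of the pairs (f, x) with f(x) = 0: each f has n roots, and each x
with [sqrt_discr](x)^2 = d is the root of exactly one f, since d != 0 forces
its n conjugates to be distinct. *)
Lemma card_irr_with_discr (d : F) n : (0 < n)%N -> d != 0 ->
  (n * #|irr_with_discr d n| =
    count (fun x => (sqrt_discr F L n).[x] ^+ 2 == iota d) (frob_fixed F L n))%N.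
Proof.
move=> n_gt0 d_neq0; set S := frob_fixed F L n; set g0 := sqrt_discr F L n.
have uS : uniq S by rewrite (frob_fixed_uniq iota).
pose I := irr_with_discr d n.
have root_orbit (f : {poly_(n.+1) F}) x : f \in I -> root f^iota x ->
    [/\ x \in S, f^iota = \prod_(y <- frob_orbit F x n) ('X - y%:P),
        uniq (frob_orbit F x n) & g0.[x] ^+ 2 = iota d].
  case/irr_with_discrP => size_f mon_f irr_f df fx.
  have [xQ uniq_x fE] := irreducible_orbit irr_f mon_f size_f fx.
  split=> //; first by rewrite mem_frob_fixed // xQ.
  by rewrite -squared_differences_orbit // -(discr_split fE).
have count_roots (f : {poly_(n.+1) F}) : f \in I -> count (root f^iota) S = n.
  move=> fI; have /irr_with_discrP[size_f _ _ _] := fI.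
  have /closed_rootP[y fy] : size f^iota != 1%N.
    by rewrite size_map_poly size_f; case: (n) n_gt0.
  have [_ fE uniq_y _] := root_orbit f y fI fy.
  rewrite -size_filter -[RHS](size_mkseq (fun i => y ^+ (q ^ i)) n) -/(frob_orbit F y n).
  apply: perm_size; apply: uniq_perm; rewrite ?filter_uniq // => z.
  rewrite mem_filter -[RHS]root_prod_XsubC -fE; apply: andb_idr => fz.
  by have [] := root_orbit f z fI fz.
have one_poly x : x \in S -> (\sum_(f in I) root f^iota x = (g0.[x] ^+ 2 == iota d))%N.
  move=> xS; have xQ : x ^+ (q ^ n) = x by apply/eqP; rewrite -mem_frob_fixed.
  case: eqP => [gx|gx]; last first.
    rewrite big1 // => f fI; apply/eqP; rewrite eqb0; apply/negP => fx.
    by have [_ _ _ /gx] := root_orbit f x fI fx.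
  have uniq_x : uniq (frob_orbit F x n).
    by apply: squared_differences_neq0; rewrite squared_differences_orbit // gx fmorph_eq0.
  have [f [irr_f mon_f size_f fE]] := orbit_irreducible iota n_gt0 xQ uniq_x.
  have size_f' : (size f <= n.+1)%N by rewrite size_f.
  pose f' : {poly_(n.+1) F} := NPoly size_f'.
  have f'I : f' \in I.
    apply/irr_with_discrP; split=> //.
    by rewrite (discr_split fE) squared_differences_orbit.
  have fx : root f'^iota x.
    rewrite /= fE root_prod_XsubC; apply/mapP; exists 0%N; rewrite ?expr1 //.
    by rewrite mem_iota n_gt0.
  rewrite (bigD1 f') //= fx big1 // => f2 /andP[f2I f2_neq]; apply/eqP; rewrite eqb0.
  apply: contra f2_neq => f2x; have [_ f2E _ _] := root_orbit f2 x f2I f2x.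
  by apply/eqP/val_inj/(map_poly_inj iota); rewrite f2E -fE.
rewrite sum_count_seq big_seq -(eq_bigr _ one_poly) -big_seq exchange_big /=.
under eq_bigr => f fI do rewrite -sum_count_seq count_roots //.
by rewrite sum_nat_const mulnC.
Qed.

Lemma eq_opp_neq0 (x : L) : 2%:R != 0 :> F -> x = - x -> x = 0.
Proof.
move=> two_neq0 /eqP; rewrite -addr_eq0 -mulr2n -mulr_natr mulf_eq0 => /orP[/eqP//|].
by rewrite -(rmorph_nat iota) fmorph_eq0 (negPf two_neq0).
Qed.

(** Euler's criterion: e^(q-1) is 1 or -1, and it is 1 exactly when e lies in F. *)
Lemma quad_char_sqrt (d : F) (e : L) k : 2%:R != 0 :> F -> d != 0 -> e ^+ 2 = iota d ->
  (quad_char d = (-1) ^+ k) <-> (e ^+ q.-1 = (-1) ^+ k).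
Proof.
move=> two_neq0 d_neq0 ed.
have q_gt0 : (0 < q)%N by rewrite ltnW ?card_field_gt1.
have e_neq0 : e != 0 by rewrite -sqrf_eq0 ed fmorph_eq0.
have one_neq : 1 <> - 1 :> L by move=> /(eq_opp_neq0 two_neq0)/eqP; rewrite oner_eq0.
have eq_pm1 : e ^+ q.-1 = 1 \/ e ^+ q.-1 = - 1.
  have : (e ^+ q.-1) ^+ 2 == 1 by rewrite exprAC ed -rmorphXn finField_unit_pow // rmorph1.
  by rewrite sqrf_eq1 => /orP[] /eqP->; [left | right].
have square_iff : [exists y : F, d == y ^+ 2] <-> e ^+ q.-1 = 1.
  split=> [/existsP[y /eqP dy]|e1].
    have y_neq0 : y != 0 by rewrite -sqrf_eq0 -dy.
    have /eqP : e ^+ 2 = (iota y) ^+ 2 by rewrite ed dy rmorphXn.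
    rewrite eqf_sqr => /orP[] /eqP->.
      by rewrite -rmorphXn finField_unit_pow ?rmorph1.
    by rewrite -rmorphN -rmorphXn finField_unit_pow ?rmorph1 ?oppr_eq0.
  have [y ey] : exists y, e = iota y.
    by apply: (fixed_by_frob iota); rewrite -(prednK q_gt0) exprS e1 mulr1.
  apply/existsP; exists y; apply/eqP/(fmorph_inj iota).
  by rewrite -ed ey rmorphXn.
rewrite /quad_char (negPf d_neq0); case: ifP => [/square_iff->|dN].
  by rewrite -signr_odd -[(-1) ^+ k in X in _ <-> X]signr_odd; case: (odd k); split.
have -> : e ^+ q.-1 = - 1 by case: eq_pm1 => // /square_iff; rewrite dN.
rewrite -signr_odd -[(-1) ^+ k in X in _ <-> X]signr_odd; case: (odd k); split=> //.
by move=> /esym/one_neq.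
Qed.

Lemma count_two_values (d : F) (e : L) (n : nat) :
  2%:R != 0 :> F -> d != 0 -> e ^+ 2 = iota d -> (0 < n)%N ->
  (n * #|irr_with_discr d n| =
    count (fun x => (sqrt_discr F L n).[x] == e) (frob_fixed F L n) +
    count (fun x => (sqrt_discr F L n).[x] == - e)%R (frob_fixed F L n))%N.
Proof.
move=> two_neq0 d_neq0 ed n_gt0; rewrite card_irr_with_discr // -count_predUI.
rewrite [X in (_ + X)%N](_ : _ = 0)%N ?addn0.
  by apply: eq_count => x; rewrite /= -ed eqf_sqr.
apply/eqP; rewrite -leqn0 leqNgt -has_count; apply/hasP => -[x _ /andP[/eqP-> /eqP]].
move=> /(eq_opp_neq0 two_neq0)/eqP e0.
by move: d_neq0; rewrite -(fmorph_eq0 iota) -ed sqrf_eq0 e0.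
Qed.

Definition monic_with_zero n (i : 'I_n) : {set {poly_(n.+1) F}} :=
  [set f : {poly_(n.+1) F} |
    [&& size f == n.+1, (f : {poly F}) \is monic & (f : {poly F})`_i == 0]].

Lemma card_monic_with_zero n (i : 'I_n) :
  (#|monic_with_zero i| <= q ^ n.-1)%N.
Proof.
pose J := {j : 'I_n | j != i}.
pose coefs (f : {poly_(n.+1) F}) : {ffun J -> F} := [ffun j : J => (f : {poly F})`_(val j : 'I_n)].
have card_J : #|{: J}| = n.-1.
  have := cardC1 i; rewrite card_ord => <-; rewrite card_sig.
  by apply: eq_card => j; rewrite !inE.
have <- : #|{ffun J -> F}| = (q ^ n.-1)%N by rewrite card_ffun card_J.
apply: leq_trans (max_card (coefs @: monic_with_zero i)).
rewrite card_in_imset // => f f'; rewrite !inE.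
case/and3P=> /eqP size_f /monicP mon_f /eqP f0 /and3P[/eqP size_f' /monicP mon_f' /eqP f0'].
move=> /ffunP ff'; apply/npolyP => k.
case: (ltngtP k n) => [ltk|gtk|->].
- have [ki|ki] := eqVneq (Ordinal ltk) i; first by move: f0 f0'; rewrite -ki /= => -> ->.
  by have := ff' (Sub (Ordinal ltk) ki); rewrite !ffunE.
- by rewrite !nth_default ?size_f ?size_f'.
by move: mon_f mon_f'; rewrite /lead_coef size_f size_f' /= => -> ->.
Qed.

(** The monic polynomial l^n f(X/l), whose roots are l times those of f. *)
Definition scale_roots n (l : F) (f : {poly_(n.+1) F}) : {poly_(n.+1) F} :=
  mk_npoly n.+1 (fun j => (f : {poly F})`_j * l ^+ (n - j)).

Lemma coef_scale_roots n l (f : {poly_(n.+1) F}) j :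
  (j <= n)%N -> (scale_roots l f : {poly F})`_j = (f : {poly F})`_j * l ^+ (n - j).
Proof. by move=> le_jn; rewrite /= coef_poly ltnS le_jn. Qed.

Lemma scale_roots_inj n l : l != 0 -> injective (@scale_roots n l).
Proof.
move=> l_neq0 f f' ff'; apply/npolyP => j.
case: (leqP j n) => [le_jn|lt_nj]; last by rewrite !big_coef_npoly.
apply: (mulIf (expf_neq0 (n - j) l_neq0)).
by rewrite -!coef_scale_roots // ff'.
Qed.

Lemma scale_roots_split n l (f : {poly_(n.+1) F}) (r : seq L) : l != 0 -> size r = n ->
  f^iota = \prod_(y <- r) ('X - y%:P) ->
  (scale_roots l f)^iota = \prod_(y <- [seq iota l * x | x <- r]) ('X - y%:P).
Proof.
move=> l_neq0 size_r fE; set c := iota l.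
have c_neq0 : c != 0 by rewrite fmorph_eq0.
have -> : \prod_(y <- [seq c * x | x <- r]) ('X - y%:P) = c ^+ n *: (f^iota \Po (c^-1 *: 'X)).
  rewrite fE -size_r big_map; elim: (r) => [|x s IH]; first by rewrite !big_nil comp_polyC scale1r.
  have factor : 'X - (c * x)%:P = c *: (c^-1 *: 'X - x%:P) :> {poly L}.
    by rewrite scalerBr scalerA mulfV // scale1r -mul_polyC -polyCM.
  rewrite !big_cons IH factor comp_polyM comp_polyB comp_polyX comp_polyC /=.
  by rewrite -scalerAl -scalerAr scalerA exprS.
apply/polyP => j; rewrite coefZ coef_map /=.
have -> : (f^iota \Po (c^-1 *: 'X))`_j = (f^iota)`_j * c^-1 ^+ j.
  rewrite comp_polyE coef_sum; under eq_bigr do rewrite exprZn coefZ coefZ coefXn.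
  case: (ltnP j (size f^iota)) => [ltj|lej].
    rewrite (bigD1 (Ordinal ltj)) //= eqxx mulr1 big1 ?addr0 // => k.
    by rewrite eq_sym -val_eqE /= => /negPf->; rewrite !mulr0.
  rewrite big1 ?[(f^iota)`_j]nth_default ?mul0r // => k _.
  by rewrite gtn_eqF ?mulr0 // (leq_trans (ltn_ord k)).
rewrite coef_poly coef_map /=; case: ltnP => [lt_jn|le_nj].
  rewrite rmorphM rmorphXn /= -/c mulrCA; congr (_ * _).
  by rewrite exprVn -expfB_cond // (negPf c_neq0).
by rewrite nth_default ?(leq_trans (size_npoly f)) // rmorph0 mul0r mulr0.
Qed.

Lemma discr_scale_roots n l (f : {poly_(n.+1) F}) : l != 0 ->
  (f : {poly F}) \is monic -> size f = n.+1 ->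
  discr (scale_roots l f) = iota l ^+ 'C(n, 2).*2 * discr f.
Proof.
move=> l_neq0 mon_f size_f.
have [r rE] := closed_field_poly_normal f^iota.
rewrite lead_coef_map (monicP mon_f) rmorph1 scale1r in rE.
have size_r : size r = n.
  by apply: succn_inj; rewrite -size_f -(size_map_poly iota) rE size_prod_XsubC.
rewrite (discr_split rE) (discr_split (scale_roots_split l_neq0 size_r rE)).
by rewrite squared_differences_scale size_r.
Qed.

Definition irr_zero_coef (d : F) n (i : 'I_n) :=
  [set f in irr_with_discr d n | (f : {poly F})`_i == 0].

(** The images of these polynomials under the q - 1 root scalings are again monic
with the same zero coefficient, and such a polynomial can be reached by at
most n(n-1) scalings l, because l^(n(n-1)) is determined by its
discriminant. *)
Lemma card_irr_zero_coef (d : F) n (i : 'I_n) : d != 0 -> (1 < n)%N ->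
  (q.-1 * #|irr_zero_coef d i| <= n ^ 2 * q ^ n.-1)%N.
Proof.
move=> d_neq0 n_gt1; set Z := irr_zero_coef d i.
have <- : (\sum_(l : F | l != 0%R) #|@scale_roots n l @: Z| = q.-1 * #|Z|)%N.
  rewrite (eq_bigr (fun=> #|Z|)) => [|l l_neq0]; last first.
    by rewrite card_imset //; exact: scale_roots_inj.
  rewrite sum_nat_const; congr (_ * _)%N.
  by rewrite -(cardC1 (0 : F)); apply: eq_card => l; rewrite !inE.
pose c2 := 'C(n, 2).*2.
have c2_gt0 : (0 < c2)%N by rewrite double_gt0 bin_gt0.
have c2_le : (c2 <= n ^ 2)%N.
  rewrite /c2 bin2 even_halfK; first by rewrite -mulnn leq_mul // leq_pred.
  by rewrite -[n in (n * _)%N]prednK ?(ltnW n_gt1) // oddM /= andNb.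
have sub_T l : l != 0 -> @scale_roots n l @: Z \subset monic_with_zero i.
  move=> l_neq0; apply/subsetP => _ /imsetP[f f_in ->].
  move: f_in; rewrite inE => /andP[/irr_with_discrP[size_f mon_f _ _] /eqP f0].
  have lead1 : (scale_roots l f : {poly F})`_n = 1.
    by rewrite coef_scale_roots // subnn expr0 mulr1; move/monicP: mon_f; rewrite /lead_coef size_f.
  have size_sf : size (scale_roots l f) = n.+1.
    apply/eqP; rewrite eqn_leq size_npoly /= ltnNge; apply/negP => sz.
    by have := lead1; rewrite nth_default // => /esym/eqP; rewrite oner_eq0.
  rewrite inE size_sf eqxx monicE /lead_coef size_sf lead1 eqxx /=.
  by rewrite coef_scale_roots ?(ltnW (ltn_ord i)) // f0 mul0r.
have cardE l : l != 0 -> #|@scale_roots n l @: Z| =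
    (\sum_(G in monic_with_zero i) (G \in @scale_roots n l @: Z))%N.
  move=> l_neq0; rewrite -sum1_card big_mkcond [RHS]big_mkcond; apply: eq_bigr => G _.
  by case: (boolP (G \in _ @: _)) => [/(subsetP (sub_T l l_neq0))-> //|_]; case: ifP.
rewrite (eq_bigr _ cardE) exchange_big /=.
apply: (@leq_trans (\sum_(G in monic_with_zero i) c2)); last first.
  by rewrite sum_nat_const mulnC leq_mul // card_monic_with_zero.
apply: leq_sum => G _; rewrite -big_mkcondr sum1_card.
pose A := [pred l : F | (l != 0) && (G \in @scale_roots n l @: Z)].
rewrite -[X in (X <= _)%N]/#|A|.
have p_neq0 : 'X^c2 - (discr G / iota d)%:P != 0 :> {poly L}.
  by rewrite -size_poly_gt0 size_XnsubC.
have := max_poly_roots p_neq0 (rs := [seq iota l | l in A]) _ _.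
rewrite size_XnsubC // ltnS size_image; apply.
  apply/allP => _ /imageP[l l_in ->]; move: l_in; rewrite !inE => /andP[l_neq0].
  case/imsetP => f f_in GE.
  move: f_in; rewrite inE => /andP[/irr_with_discrP[size_f mon_f _ df] _].
  rewrite rootE !hornerE GE discr_scale_roots // df mulfK ?subrr //.
  by rewrite fmorph_eq0.
by rewrite map_inj_uniq ?enum_uniq //; exact: fmorph_inj.
Qed.

Lemma irr_discr_set_sub (d : F) n : irr_discr_set d n \subset irr_with_discr d n.
Proof.
apply/subsetP => f; rewrite !inE => /and5P[sf mf irf _ df].
by rewrite sf mf irf.
Qed.

Lemma card_irr_discr_set_ge (d : F) n : d != 0 -> (1 < n)%N ->
  (q.-1 * #|irr_with_discr d n| <=
    q.-1 * #|irr_discr_set d n| + n * (n ^ 2 * q ^ n.-1))%N.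
Proof.
move=> d_neq0 n_gt1; pose Z (i : 'I_n) := irr_zero_coef d i.
have cover : irr_with_discr d n \subset irr_discr_set d n :|: \bigcup_i Z i.
  apply/subsetP => f fI; rewrite in_setU.
  case: (boolP [forall i : 'I_n, (f : {poly F})`_i != 0]) => [nz|].
    by move: fI; rewrite !inE => /and4P[-> -> -> ->]; rewrite nz.
  rewrite negb_forall => /existsP[i]; rewrite negbK => fi.
  by apply/orP; right; apply/bigcupP; exists i => //; rewrite inE fI.
have : (#|irr_with_discr d n| <= #|irr_discr_set d n| + \sum_i #|Z i|)%N.
  apply: leq_trans (subset_leq_card cover) _; apply: leq_trans (leq_card_setU _ _) _.
  by rewrite leq_add2l; elim/big_ind2: _ => [|A a B b Aa Bb|//];
     rewrite ?cards0 // (leq_trans (leq_card_setU _ _)) // leq_add.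
rewrite -(leq_pmul2l (_ : 0 < q.-1)%N); last by have := card_field_gt1 F; lia.
move=> le_card; apply: leq_trans le_card _; rewrite mulnDr leq_add2l big_distrr /=.
apply: leq_trans (leq_sum _ (fun i _ => card_irr_zero_coef i d_neq0 n_gt1)) _.
by rewrite sum_nat_const card_ord.
Qed.

End IrreducibleCount.

(** * Estimates and conclusion *)

(** M is the integral part of the quotient of the square root of X by n. *)
Lemma vanishing_order (n X : nat) : (0 < n)%N -> (n ^ 2 <= X)%N ->
  exists M, [/\ (0 < M)%N, (n ^ 2 * M ^ 2 <= X)%N & (X < n ^ 2 * M.+1 ^ 2)%N].
Proof.
move=> n_gt0 nX; pose p M := (n ^ 2 * M ^ 2 <= X)%N.
have p1 : exists M, p M by exists 1%N; rewrite /p muln1.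
have p_le M : p M -> (M <= X)%N.
  apply: leq_trans; rewrite -[(M ^ 2)%N]mulnn mulnA.
  by case: M => // M; rewrite leq_pmull // muln_gt0 expn_gt0 n_gt0.
have [M pM max_M] := ex_maxnP p1 p_le; exists M; split=> //.
  by apply: max_M; rewrite /p muln1.
by rewrite ltnNge; apply/negP => /max_M; rewrite ltnn.
Qed.

Lemma unscale_estimate (R : realFieldType) (n s P I0 : R) : 0 < n -> 0 < s ->
  `|n * I0 - 2 * P| * s <= 218 * n ^+ 3 * P ->
  `|I0 - 2 / n * P| <= 218 * n ^+ 2 * (P / s).
Proof.
move=> n_gt0 s_gt0 scale.
have -> : I0 - 2 / n * P = (n * I0 - 2 * P) / n by field; lra.
rewrite normrM normfV [`|n|]gtr0_norm // ler_pdivrMr //.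
have -> : 218 * n ^+ 2 * (P / s) * n = 218 * n ^+ 3 * P / s by field; lra.
by rewrite ler_pdivlMr.
Qed.

Lemma trivial_estimate (R : realFieldType) (n q s P I0 I : R) :
  1 <= n -> 0 < s -> 0 <= P -> 0 <= I0 -> I0 <= I -> q = s ^+ 2 ->
  s <= n -> 2 <= q -> n * I <= q * P ->
  `|I0 - 2 / n * P| <= 218 * n ^+ 2 * (P / s).
Proof.
move=> n_ge1 s_gt0 P_ge0 I0_ge0 I0_le qE sn q_ge2 nI; have n_gt0 : 0 < n by lra.
have scale : `|n * I0 - 2 * P| * s <= 218 * n ^+ 3 * P.
  have abs_le : `|n * I0 - 2 * P| <= q * P.
    have : 0 <= n * I0 by rewrite mulr_ge0 // ltW.
    have : n * I0 <= n * I by rewrite ler_wpM2l // ltW.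
    have : 2 * P <= q * P by rewrite ler_wpM2r.
    by rewrite ler_norml; move=> *; apply/andP; split; lra.
  have s3 : s ^+ 3 <= n ^+ 3 by rewrite lerXn2r // nnegrE ltW.
  apply: (@le_trans _ _ (q * P * s)); first by rewrite ler_wpM2r // ltW.
  have -> : q * P * s = s ^+ 3 * P by rewrite qE; ring.
  have : 0 <= n ^+ 3 * P by rewrite mulr_ge0 // exprn_ge0 // ltW.
  have : s ^+ 3 * P <= n ^+ 3 * P by rewrite ler_wpM2r.
  by lra.
exact: unscale_estimate.
Qed.

(** Here P = q^(n-1), s = q^(1/2) and D = Q q^((n-1)/2) with the exponent rounded down;
the hypothesis on D s states that the chosen order M makes D / M at most
2 n q^(n-1/2). Every error term is compared with n^3 s P. *)
Lemma main_estimate (R : realFieldType) (n q s P I0 I m M A D : R) :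
  1 <= n -> 0 < s -> 0 <= P -> 0 <= I0 -> I0 <= I -> q = s ^+ 2 ->
  n <= s -> 2 <= q -> 0 < M -> 0 <= m -> m <= n ^+ 2 -> A <= P -> 0 <= A ->
  M * ((q - 1) * (n * I)) <= 2 * (M * (q * P)) + 50 * (m * D) ->
  2 * (M * (q * P)) <= M * ((q - 1) * (n * I)) + 50 * (m * D) + 6 * (M * (m * A)) ->
  D * s <= 2 * n * M * (q * P) ->
  (q - 1) * I <= (q - 1) * I0 + n ^+ 3 * P ->
  `|I0 - 2 / n * P| <= 218 * n ^+ 2 * (P / s).
Proof.
move=> n_ge1 s_gt0 P_ge0 I0_ge0 I0_le qE ns q_ge2 M_gt0 m_ge0 mn AP A_ge0 upper lower Ds zeros.
have n_gt0 : 0 < n by lra.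
pose E := n ^+ 3 * (s * P).
have E_ge0 : 0 <= E by rewrite !mulr_ge0 // ?exprn_ge0 // ltW.
have D_le : D <= 2 * n * M * (s * P).
  rewrite -(ler_pM2r s_gt0) (le_trans Ds) // qE.
  by have -> : 2 * n * M * (s ^+ 2 * P) = 2 * n * M * (s * P) * s by ring.
have mD : m * D <= 2 * (M * E).
  apply: (@le_trans _ _ (m * (2 * n * M * (s * P)))); first by rewrite ler_wpM2l.
  have -> : 2 * (M * E) = n ^+ 2 * (2 * n * M * (s * P)) by rewrite /E; ring.
  by rewrite ler_wpM2r // !mulr_ge0 // ltW.
have s_ge1 : 1 <= s by lra.
have small (a : R) : 0 <= a -> a <= n ^+ 3 * s -> a * P <= E.
  by move=> a_ge0 a_le; rewrite /E mulrA ler_wpM2r.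
have n3_ge : n ^+ 2 <= n ^+ 3 * s.
  have -> : n ^+ 3 * s = n ^+ 2 * (n * s) by ring.
  rewrite -[X in X <= _]mulr1 ler_wpM2l ?mulr_ege1 //.
  by rewrite exprn_ge0 // ltW.
have mA : m * A <= E.
  apply: le_trans (small (n ^+ 2) _ n3_ge); last by rewrite exprn_ge0 // ltW.
  by apply: ler_pM.
have P_le : P <= E.
  rewrite -[P]mul1r; apply: small => //; apply: le_trans n3_ge.
  by rewrite exprn_ege1.
have n4 : n ^+ 4 * P <= E.
  apply: small; first by rewrite exprn_ge0 // ltW.
  by rewrite [n ^+ 4]exprSr ler_wpM2l // exprn_ge0 // ltW.
have upper' : (q - 1) * (n * I) <= 2 * (q * P) + 100 * E.
  rewrite -(ler_pM2l M_gt0); apply: le_trans upper _; lra.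
have lower' : 2 * (q * P) <= (q - 1) * (n * I) + 106 * E.
  rewrite -(ler_pM2l M_gt0) mulrDr; move: lower.
  have : M * (m * A) <= M * E by rewrite ler_wpM2l // ltW.
  lra.
have zeros' : (q - 1) * (n * I) <= (q - 1) * (n * I0) + E.
  have : n * ((q - 1) * I) <= n * ((q - 1) * I0 + n ^+ 3 * P) by rewrite ler_wpM2l // ltW.
  have -> : n * ((q - 1) * I0 + n ^+ 3 * P) = (q - 1) * (n * I0) + n ^+ 4 * P by ring.
  by rewrite mulrCA; lra.
have I0I : (q - 1) * (n * I0) <= (q - 1) * (n * I).
  by rewrite !ler_wpM2l ?(ltW n_gt0) // subr_ge0; lra.
have abs_le : (q - 1) * `|n * I0 - 2 * P| <= 109 * E.
  rewrite -[q - 1]ger0_norm; last by lra.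
  by rewrite -normrM ler_norml; apply/andP; split; lra.
have scale : `|n * I0 - 2 * P| * s <= 218 * n ^+ 3 * P.
  rewrite -(ler_pM2r s_gt0).
  have -> : 218 * n ^+ 3 * P * s = 218 * E by rewrite /E; ring.
  have -> : `|n * I0 - 2 * P| * s * s = q * `|n * I0 - 2 * P| by rewrite qE; ring.
  have : q * `|n * I0 - 2 * P| <= (2 * (q - 1)) * `|n * I0 - 2 * P|.
    by rewrite ler_wpM2r //; lra.
  by lra.
exact: unscale_estimate.
Qed.

Lemma powR_sub_3_2 (R : realType) (x : R) n : 0 < x -> (0 < n)%N ->
  x `^ (n%:R - 3 / 2) = x ^+ n.-1 / Num.sqrt x.
Proof.
move=> x_gt0 n_gt0.
have -> : n%:R - 3 / 2 = n.-1%:R + - (2^-1) :> R.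
  by rewrite -[in LHS](prednK n_gt0) -natr1; field.
rewrite powRD; last by rewrite (gt_eqF x_gt0) implybT.
by rewrite powR_mulrn ?(ltW x_gt0) // powRN powR12_sqrt // ltW.
Qed.

(** The order M is taken as large as [stepanov_sqrt_discr] allows. *)
Lemma irr_discr_estimate (R : realType) (n : nat) (F : finFieldType) (d : F) :
  (1 < n)%N -> 2%:R != 0 :> F -> d != 0 -> quad_char d = (-1) ^+ (n - 1) ->
  `| #|irr_discr_set d n|%:R - 2 / n%:R * #|F|%:R ^+ (n - 1) |
    <= 218 * n%:R ^+ 2 * #|F|%:R `^ (n%:R - 3 / 2) :> R.
Proof.
move=> n_gt1 two_neq0 d_neq0 chi_d; have n_gt0 := ltnW n_gt1.
set q := #|F|; have q_gt1 : (1 < q)%N := card_field_gt1 F.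
have q_gt0 : 0 < q%:R :> R by rewrite ltr0n ltnW.
rewrite powR_sub_3_2 // subn1; set s := Num.sqrt _.
have sE : s ^+ 2 = q%:R by rewrite sqr_sqrtr // ltW.
have s_gt0 : 0 < s by rewrite sqrtr_gt0.
have n_ge1 : 1 <= n%:R :> R by rewrite ler1n.
have I0_le : #|irr_discr_set d n|%:R <= #|irr_with_discr d n|%:R :> R.
  by rewrite ler_nat subset_leq_card // irr_discr_set_sub.
have P_ge0 : 0 <= q%:R ^+ n.-1 :> R by rewrite exprn_ge0 // ltW.
have qn : q%:R * q%:R ^+ n.-1 = q%:R ^+ n :> R by rewrite -exprS prednK.
have q_ge2 : 2 <= q%:R :> R by rewrite ler_nat.
have [e ed] : exists e, e ^+ 2 = to_closure F d.
  have /closed_rootP[e] : size ('X^2 - (to_closure F d)%:P) != 1%N by rewrite size_XnsubC.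
  by rewrite rootE !hornerE subr_eq0 => /eqP ee; exists e.
rewrite subn1 in chi_d.
have eq1 := (quad_char_sqrt n.-1 two_neq0 d_neq0 ed).1 chi_d.
have two_values := count_two_values two_neq0 d_neq0 ed n_gt0.
have [nq|qn_lt] := leqP (n ^ 2) q; last first.
  apply: (trivial_estimate n_ge1 s_gt0 P_ge0 (ler0n _ _) I0_le (esym sE) _ q_ge2).
    rewrite -(ler_pXn2r (_ : 0 < 2)%N) ?nnegrE ?ler0n ?(ltW s_gt0) // sE.
    by rewrite -natrX ler_nat ltnW.
  rewrite qn -natrM -natrX ler_nat card_irr_with_discr //.
  by rewrite (leq_trans (count_size _ _)) // size_frob_fixed.
have q_gt2 : (2 < q)%N.
  by apply: leq_trans nq; rewrite (@leq_trans (2 ^ 2)) // leq_exp2r.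
have halves : (n./2 + n.-1./2 = n.-1)%N.
  by case: (n) n_gt0 => //= k _; rewrite uphalf_half -addnA addnn odd_double_half.
have nX : (n ^ 2 <= q ^ (n + n.-1./2 - n./2))%N.
  by apply: leq_trans nq _; rewrite -{1}[q]expn1 leq_exp2l //; move: halves n_gt0; clear; lia.
have [M [M_gt0 MX XM]] := vanishing_order n_gt0 nX.
have ned2 : (- e) ^+ 2 = to_closure F d by rewrite sqrrN.
have ned := (quad_char_sqrt n.-1 two_neq0 d_neq0 ned2).1 chi_d.
have [up1 low1] := count_value_bounds (to_closure F) n_gt1 q_gt2 nq MX eq1.
have [up2 low2] := count_value_bounds (to_closure F) n_gt1 q_gt2 nq MX ned.
have zeros := card_irr_discr_set_ge d_neq0 n_gt1.
have mn := gcd_bin_card_le F n_gt1.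
move: up1 low1 up2 low2 two_values zeros mn.
set m := gcdn _ _; set N1 := count _ _; set N2 := count _ _.
set I := #|irr_with_discr d n|; set I0 := #|irr_discr_set d n|.
rewrite -/q; set Q := (q ^ n)%N; set B := (q ^ _)%N; set A := (q ^ n./2)%N.
move=> up1 low1 up2 low2 two_values zeros mn.
have q1E : q.-1%:R = q%:R - 1 :> R by rewrite -subn1 natrB // ltnW.
have QE : Q%:R = q%:R * q%:R ^+ n.-1 :> R by rewrite qn natrX.
have split_values : (M * (q.-1 * N1) + M * (q.-1 * N2) = M * (q.-1 * (n * I)))%N.
  by rewrite two_values !mulnDr.
have upper : (M * (q.-1 * (n * I)) <= 2 * (M * Q) + 50 * (m * (Q * B)))%N.
  by rewrite -split_values; move: up1 up2; clear; lia.
have lower : (2 * (M * Q) <= M * (q.-1 * (n * I)) + 50 * (m * (Q * B)) + 6 * (M * (m * A)))%N.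
  by rewrite -split_values; move: low1 low2; clear; lia.
have Ds : (Q * B)%:R * s <= 2 * n%:R * M%:R * (q%:R * q%:R ^+ n.-1).
  rewrite -(ler_pXn2r (_ : 0 < 2)%N) ?nnegrE ?mulr_ge0 ?ler0n ?(ltW s_gt0) //.
  rewrite exprMn sE -QE -!natrM -!natrX -natrM ler_nat.
  (* (Q B)^2 q = X Q^2, and X < n^2 (M + 1)^2 by the choice of M. *)
  have -> : ((Q * B) ^ 2 * q = q ^ (n + n.-1./2 - n./2) * Q ^ 2)%N.
    rewrite /Q /B expnMn -!expnM -!expnD -expnSr; congr (_ ^ _)%N.
    by move: halves n_gt0; clear; lia.
  rewrite !expnMn leq_mul //; apply: leq_trans (ltnW XM) _.
  by rewrite mulnAC mulnC leq_mul // -expnMn leq_exp2r //; move: M_gt0; clear; lia.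
apply: (main_estimate n_ge1 s_gt0 P_ge0 (ler0n _ _) I0_le (esym sE) _ q_ge2
  (_ : 0 < M%:R) (ler0n _ m) _ (_ : A%:R <= _) (ler0n _ _) _ _ Ds _).
- rewrite -(ler_pXn2r (_ : 0 < 2)%N) ?nnegrE ?ler0n ?(ltW s_gt0) // sE.
  by rewrite -natrX ler_nat.
- by rewrite ltr0n.
- by rewrite -natrX ler_nat.
- by rewrite -natrX ler_nat leq_exp2l //; move: halves; clear; lia.
- by rewrite -QE -q1E -!natrM -natrD ler_nat.
- by rewrite -QE -q1E -!natrM -!natrD ler_nat.
by rewrite -q1E -!natrX -!natrM -natrD ler_nat; move: zeros; rewrite !expnS expn0; clear; lia.
Qed.

Lemma irr_discr_empty (n : nat) (F : finFieldType) (d : F) :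
  (1 < n)%N -> 2%:R != 0 :> F -> d != 0 -> quad_char d <> (-1) ^+ (n - 1) ->
  #|irr_discr_set d n| = 0%N.
Proof.
move=> n_gt1 two_neq0 d_neq0 chi_d; apply/eqP; rewrite -leqn0.
have n_gt0 := ltnW n_gt1.
apply: leq_trans (subset_leq_card (irr_discr_set_sub d n)) _.
rewrite -(leq_pmul2l n_gt0) muln0 card_irr_with_discr // leqNgt -has_count.
apply/hasP => -[x]; rewrite mem_frob_fixed // => /eqP xQ /eqP gx.
apply/chi_d/(quad_char_sqrt _ two_neq0 d_neq0 gx); rewrite subn1.
apply: (sqrt_discr_pow (to_closure F) n_gt0 xQ).
by rewrite -sqrf_eq0 gx fmorph_eq0.
Qed.

Theorem theoremA2 (R : realType) :
  exists C : R, 0 < C /\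
    forall (n : nat) (F : finFieldType) (p : nat) (d : F),
      (2 <= n)%N -> p \in [pchar F] -> (2 < p)%N -> d != 0 ->
      (quad_char d = (-1) ^+ (n - 1) ->
         `| #|irr_discr_set d n|%:R - 2 / n%:R * #|F|%:R ^+ (n - 1) |
           <= C * n%:R ^+ 2 * #|F|%:R `^ (n%:R - 3 / 2)) /\
      (quad_char d <> (-1) ^+ (n - 1) -> #|irr_discr_set d n| = 0%N).
Proof.
exists 218; split=> // n F p d n_ge2 pF p_gt2 d_neq0.
have two_neq0 : 2%:R != 0 :> F.
  by rewrite -(dvdn_pcharf pF) gtnNdvd.
by split; [exact: irr_discr_estimate | exact: irr_discr_empty].
Qed.
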